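(* Let $f\in\mathcal{C}$ and $\theta\in\mathbb{R}$. (a) For an integer $k\ge1$ define a sequence of $k\times k$ matrices by $B_0(r,s):=e^{\theta f(r/k,s/k)}$ for $1\le r,s\le k$ and, for $m\ge0$, $$B_{2m+1}(r,s):=\frac{B_{2m}(r,s)}{k\sum_{l=1}^k B_{2m}(r,l)},\qquad B_{2m+2}(r,s):=\frac{B_{2m+1}(r,s)}{k\sum_{l=1}^k B_{2m+1}(l,s)}.$$ Then there exists a matrix $A_{k,\theta}\in\mathcal{M}_k$ such that $\lim_{m\to\infty}B_m=A_{k,\theta}$. (b) $A_{k,\theta}$ is the unique maximizer of the optimization problem $$\sup_{A\in\mathcal{M}_k}\Big\{\theta\sum_{r,s=1}^k f(r/k,s/k)A(r,s)-2\log k-\sum_{r,s=1}^k A(r,s)\log A(r,s)\Big\}.$$ (c) The function $$W_k(f,\theta):=\sup_{A\in\mathcal{M}_k}\Big\{\theta\sum_{r,s=1}^k f(r/k,s/k)A(r,s)-2\log k-\sum_{r,s=1}^k A(r,s)\log A(r,s)\Big\}$$ is a convex differentiable function of $\theta\in\mathbb{R}$ with $$W_k'(f,\theta)=\sum_{r,s=1}^k A_{k,\theta}(r,s)f(r/k,s/k).$$ (d) For any continuous function $\phi:[0,1]^2\to\mathbb{R}$, $$\lim_{k\to\infty}\sum_{r,s=1}^k A_{k,\theta}(r,s)\phi(r/k,s/k)=\int_{[0,1]^2}\phi(x,y)g_{f,\theta}(x,y)\,dx\,dy.$$ In particular, $$Z(f,\theta)=\lim_{k\to\infty}W_k(f,\theta)=\lim_{k\to\infty}\lim_{m\to\infty}\Big\{\theta\sum_{i,j=1}^k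 f(i/k,j/k)B_m(i,j)-2\log k-\sum_{i,j=1}^k B_m(i,j)\log B_m(i,j)\Big\}.$$
   Context: $\mathcal{C}$ is the set of all continuous functions $f:[0,1]^2\to\mathbb{R}$, not identically $0$, with $\int_0^1 f(x,z)\,dz=0$ for all $x\in[0,1]$ and $\int_0^1 f(z,y)\,dz=0$ for all $y\in[0,1]$. $\mathcal{M}_k$ is the set of $k\times k$ matrices with non-negative entries whose row sums and column sums all equal $1/k$. Convention: $0\log0=0$. $\mathcal{M}$ is the set of all Borel probability measures on $[0,1]^2$ with both marginals uniform on $[0,1]$; $u$ is the uniform distribution on $[0,1]^2$; $\mu[f]:=\int f\,d\mu$; $D(\cdot\|\cdot)$ is the Kullback-Leibler divergence. $Z(f,\theta):=\sup_{\mu\in\mathcal{M}}\{\theta\mu[f]-D(\mu\|u)\}$. This supremum is attained at a unique measure $\mu_{f,\theta}\in\mathcal{M}$, and $g_{f,\theta}$ denotes the density of $\mu_{f,\theta}$ with respect to Lebesgue measure on $[0,1]^2$ (which exists and is of the form $e^{\theta f(x,y)+a_{f,\theta}(x)+b_{f,\theta}(y)}$ with $a_{f,\theta},b_{f,\theta}\in L^1[0,1]$). $W_k'$ denotes the derivative with respect to $\theta$. *)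

(* Defs.v *)
From HB Require Import structures.
From mathcomp Require Import all_boot all_order all_algebra.
From mathcomp Require Import all_classical all_reals all_analysis.

Set Implicit Arguments.
Unset Strict Implicit.
Unset Printing Implicit Defensive.

Import Order.TTheory GRing.Theory Num.Theory.
Import numFieldNormedType.Exports.

Local Open Scope classical_set_scope.
Local Open Scope ring_scope.

Definition argmax d (T : Type) (Y : porderType d) (S : set T) (F : T -> Y)
    : set T :=
  [set x | S x /\ forall y, S y -> (F y <= F x)%O].

(* Functions on [0,1]^2 are represented by functions on the plane, of which
   only the values on the square matter. *)
Definition unit_square (R : realType) : set (R * R) := `[0, 1] `*` `[0, 1].

Definition classC (R : realType) : set (R * R -> R) :=
  [set f | [/\ {within @unit_square R, continuous f},
      exists2 z, unit_square z & f z != 0,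
      forall x, x \in `[0, 1] ->
        \int[lebesgue_measure]_(z in `[0, 1]) f (x, z) = 0 &
      forall y, y \in `[0, 1] ->
        \int[lebesgue_measure]_(z in `[0, 1]) f (z, y) = 0]].

Section discrete.
Variables (R : realType) (k : nat).

Definition Mk : set 'M[R]_k :=
  [set A | [/\ forall r s, 0 <= A r s,
      forall r, \sum_s A r s = k%:R^-1 &
      forall s, \sum_r A r s = k%:R^-1]].

(* Ordinals start at 0: the index r : 'I_k stands for r + 1 in {1, ..., k}. *)
Definition grid (r s : 'I_k) : R * R := (r.+1%:R / k%:R, s.+1%:R / k%:R).

Definition row_scale (B : 'M[R]_k) : 'M[R]_k :=
  \matrix_(r, s) (B r s / (k%:R * \sum_l B r l)).

Definition col_scale (B : 'M[R]_k) : 'M[R]_k :=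
  \matrix_(r, s) (B r s / (k%:R * \sum_l B l s)).

Fixpoint sinkhorn (f : R * R -> R) (theta : R) (m : nat) : 'M[R]_k :=
  if m is n.+1 then
    (if odd n then col_scale else row_scale) (sinkhorn f theta n)
  else \matrix_(r, s) expR (theta * f (grid r s)).

(* The convention 0 log 0 = 0 holds since 0 * ln 0 = 0. *)
Definition objk (f : R * R -> R) (theta : R) (A : 'M[R]_k) : R :=
  theta * (\sum_r \sum_s f (grid r s) * A r s) - 2 * ln k%:R
  - \sum_r \sum_s A r s * ln (A r s).

Definition W (f : R * R -> R) (theta : R) : R :=
  sup [set objk f theta A | A in Mk].

End discrete.

Section continuous.
Variable R : realType.
Local Notation R2 := (measurableTypeR R * measurableTypeR R)%type.

Definition unif1 : probability (measurableTypeR R) R := uniform_prob (@ltr01 R).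

Definition unif2 : probability R2 R := (unif1 \x unif1)%E.

(* The marginal conditions force mu to be carried by the unit square. *)
Definition couplings : set (probability R2 R) :=
  [set mu : probability R2 R |
     forall A : set (measurableTypeR R), measurable A ->
     pushforward mu fst A = unif1 A /\ pushforward mu snd A = unif1 A].

Definition KL d (T : measurableType d) (mu nu : probability T R) : \bar R :=
  if `[< mu `<< nu >] then
    (\int[mu]_z
       (ln (fine (Radon_Nikodym (charge_of_finite_measure mu) nu z)))%:E)%E
  else +oo%E.

Definition obj (f : R * R -> R) (theta : R) (mu : probability R2 R) : \bar R :=
  ((theta * \int[mu]_(z in @unit_square R) f z)%R%:E - KL mu unif2)%E.

Definition Z (f : R * R -> R) (theta : R) : \bar R :=
  ereal_sup [set obj f theta mu | mu in couplings].

(* The maximizer of the variational problem; unif2 is only a default value. *)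
Definition mu_opt (f : R * R -> R) (theta : R) : probability R2 R :=
  xget unif2 (argmax couplings (obj f theta)).

(* unif2 is the Lebesgue measure of [0,1]^2, so that this is the density with
   respect to the Lebesgue measure of [0,1]^2. *)
Definition g_opt (f : R * R -> R) (theta : R) (z : R2) : R :=
  fine (Radon_Nikodym (charge_of_finite_measure (mu_opt f theta)) unif2 z).

End continuous.

(* Main.v *)
Require Import Defs.
From HB Require Import structures.
From mathcomp Require Import all_boot all_order all_algebra.
From mathcomp Require Import all_classical all_reals all_analysis.
From mathcomp Require Import measurable_realfun ring lra.
Set Implicit Arguments.
Unset Strict Implicit.
Unset Printing Implicit Defensive.
Import Order.TTheory GRing.Theory Num.Theory.
Import numFieldNormedType.Exports.
Local Open Scope classical_set_scope.
Local Open Scope ring_scope.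

(** The discrete and the continuous optimization problems are both governed by
    a Schroedinger system: find l(x, y) = theta f(x, y) + a(x) + b(y) such that
    exp l has uniform marginals (schrodinger), where averages are means over
    the k grid indices in one case and integrals over [0,1] in the other.

    Everything rests on one contraction estimate (avg_expR_contract): if p and
    p' are probability densities with p >= d p', then replacing p' by p lowers
    the logarithm of the average of exp h by at most (1 - d) times the
    oscillation of h. The normalization of exp l bounds the potentials, so that
    the conditional densities of a solution are comparable, with
    d = exp (- 4 sup |theta f|) independent of k. There are two consequences.

    Convergence of the iteration. A step multiplies the rows, or the columns,
    of the matrix by factors whose logarithms are, up to sign, logarithms of
    averages of the previous factors; their oscillation, and with it their
    size, decays geometrically, so the logarithms of the entries converge
    (sinkhorn_limit), and the limit solves the discrete system.

    Stability. Two solutions for functions F and F' at uniform distance eps are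
    at distance at most C eps, with C depending on sup |F| only
    (schrodinger_stable). This makes the optimal matrix a continuous function of
    theta, and since the value is a supremum of affine functions of theta, the
    subgradient inequalities give its derivative (W_derivative). It also
    compares different values of k: a discrete solution, extended to a step
    function, solves the continuous system for the step function of f, and
    these step functions converge uniformly to f. So the discrete log-densities
    form a uniform Cauchy sequence, whose limit solves the continuous system
    (schrodinger_limit), with no compactness argument for measures.

    Optimality is Gibbs' inequality. Under the marginal constraints the
    separable part of l contributes a constant, so that up to this constant the
    objective is minus the relative entropy with respect to exp l: see objkE
    for matrices, gibbs_KL_ge and gibbs_KL_eq for measures. Hence the solution
    is the unique maximizer and the constant is the optimal value; the limits
    in k follow from uniform convergence. *)

(** * Contraction of oscillations under averaging *)

(** The contraction argument is run twice, for finite sums and for Lebesgue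
    integrals over [0,1]; both are positive normalized linear functionals on an
    algebra of functions that is stable under the exponential. *)
Record averaging (R : realType) (T : Type) (adm : set (T -> R))
    (I : (T -> R) -> R) : Prop := Averaging {
  adm_cst : forall c, adm (fun=> c);
  adm_add : forall u v, adm u -> adm v -> adm (fun x => u x + v x);
  adm_mul : forall u v, adm u -> adm v -> adm (fun x => u x * v x);
  adm_exp : forall u, adm u -> adm (fun x => expR (u x));
  avgD : forall u v, adm u -> adm v -> I (fun x => u x + v x) = I u + I v;
  avgZ : forall c u, adm u -> I (fun x => c * u x) = c * I u;
  avg_ge0 : forall u, adm u -> (forall x, 0 <= u x) -> 0 <= I u;
  avg1 : I (fun=> 1) = 1
}.

(** Convexity of the exponential, applied to the points 0 and - D. *)
Lemma expR_convex_comb (R : realType) (d D : R) : 0 <= d <= 1 ->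
  expR (- ((1 - d) * D)) <= d + (1 - d) * expR (- D).
Proof.
move=> /andP[d0 d1]; set w := (1 - d) * D.
(* Tangent line at the point - w, the convex combination of 0 and - D. *)
have tangent t : expR (- w) * (1 + (t + w)) <= expR t.
  rewrite -[in leRHS](addKr w t) expRD ler_wpM2l ?expR_ge0//.
  by rewrite (addrC w) expR_ge1Dx.
have h0 := tangent 0; have hD := tangent (- D).
have -> : expR (- w) = d * (expR (- w) * (1 + (0 + w)))
    + (1 - d) * (expR (- w) * (1 + (- D + w))) by rewrite /w; ring.
rewrite lerD//; last by rewrite ler_wpM2l// subr_ge0.
by rewrite -[leRHS]mulr1 ler_wpM2l// -[leRHS]expR0.
Qed.

Section Contraction.
Variables (R : realType) (T : Type) (adm : set (T -> R)) (I : (T -> R) -> R).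
Hypothesis HI : averaging adm I.

Lemma adm_scale c u : adm u -> adm (fun x => c * u x).
Proof. by move=> hu; apply: (adm_mul HI) => //; exact: adm_cst HI c. Qed.

Lemma adm_opp u : adm u -> adm (fun x => - u x).
Proof.
move=> /(adm_scale (-1)); congr adm.
by apply/funext => x; rewrite mulN1r.
Qed.

Lemma avg_le u v : adm u -> adm v -> (forall x, u x <= v x) -> I u <= I v.
Proof.
move=> hu hv uv; rewrite -subr_ge0 -mulN1r -(avgZ HI)//.
rewrite -(avgD HI)//; last exact: adm_scale.
apply: (avg_ge0 HI) => [|x]; first by apply: (adm_add HI) => //; exact: adm_scale.
by rewrite mulN1r subr_ge0.
Qed.

(** Writing p = d p' + (1 - d) q with q again a probability density, the
    average of exp h under p is a convex combination of its averages under p'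
    and q, and the latter is at least exp (- D) times the former. *)
Lemma avg_expR_contract (p p' h : T -> R) (d D : R) :
  adm p -> adm p' -> adm h -> 0 <= d <= 1 ->
  (forall t, 0 <= p' t) -> (forall t, d * p' t <= p t) ->
  I p = 1 -> I p' = 1 -> (forall s t, h s - h t <= D) ->
  I (fun t => p' t * expR (h t)) <=
    expR ((1 - d) * D) * I (fun t => p t * expR (h t)).
Proof.
move=> ap ap' ah d01 p'0 pp' Ip Ip' hD.
have aeh := adm_exp HI ah.
have ape := adm_mul HI ap aeh; have ape' := adm_mul HI ap' aeh.
set E' := I _; set E := I _.
have E'0 : 0 <= E'.
  by apply: (avg_ge0 HI) => // t; rewrite mulr_ge0 ?expR_ge0.
have H1 t : expR (- D) * E' <= expR (h t).
  rewrite -[leRHS](addKr D) -?expRD.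
  have -> : expR (h t) = expR (- D) * (expR (h t + D) * I p').
    by rewrite Ip' mulr1 -expRD; congr expR; ring.
  rewrite addKr ler_wpM2l ?expR_ge0// -(avgZ HI)//.
  apply: avg_le => //; first exact: adm_scale.
  by move=> s; rewrite mulrC ler_wpM2r// ler_expR; have := hD s t; lra.
have H2 : 0 <= E - d * E' - expR (- D) * E' + d * (expR (- D) * E').
  have -> : E - d * E' - expR (- D) * E' + d * (expR (- D) * E') =
    E + (- d) * E' + (- (expR (- D) * E')) * I p + d * (expR (- D) * E') * I p'.
    by rewrite Ip Ip'; ring.
  rewrite -(avgZ HI (- (expR (- D) * E')) ap).
  rewrite -(avgZ HI (d * (expR (- D) * E')) ap') -(avgZ HI (- d) ape').
  have A1 := adm_add HI ape (adm_scale (- d) ape').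
  have A2 := adm_add HI A1 (adm_scale (- (expR (- D) * E')) ap).
  have A3 := adm_add HI A2 (adm_scale (d * (expR (- D) * E')) ap').
  rewrite -(avgD HI)//; last exact: adm_scale.
  rewrite -(avgD HI)//; last exact: adm_scale.
  rewrite -(avgD HI)//; last exact: adm_scale.
  apply: (avg_ge0 HI) => // t.
  have -> : p t * expR (h t) + - d * (p' t * expR (h t)) +
   - (expR (- D) * E') * p t + d * (expR (- D) * E') * p' t =
   (p t - d * p' t) * (expR (h t) - expR (- D) * E') by ring.
  by rewrite mulr_ge0// subr_ge0.
have H3 := expR_convex_comb D d01.
have -> : E' = expR ((1 - d) * D) * (expR (- ((1 - d) * D)) * E').
  by rewrite mulrA -expRD subrr expR0 mul1r.
rewrite ler_wpM2l ?expR_ge0//.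
have := ler_wpM2r E'0 H3; lra.
Qed.

Section Rows.
Variables (F : T -> T -> R) (a b : T -> R) (M : R).
Hypothesis FM : forall x y, `|F x y| <= M.
Hypothesis aF : forall x, adm (F x).
Hypothesis ab : adm b.
Hypothesis rows : forall x, I (fun y => expR (F x y + a x + b y)) = 1.

Let adm_row x : adm (fun y => expR (F x y + a x + b y)).
Proof.
apply: (adm_exp HI); apply: (adm_add HI) => //.
by apply: (adm_add HI) => //; exact: adm_cst HI _.
Qed.

(** Both rows have mass one while their densities differ, up to the factor
    exp (a x - a x'), by at most a factor exp (2 M). *)
Lemma row_potential_osc x x' : a x - a x' <= 2 * M.
Proof.
have : expR (a x - a x' - 2 * M) * 1 <= 1.
  rewrite -[X in _ * X](rows x') -[leRHS](rows x) -(avgZ HI)//.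
  apply: avg_le => //; first exact: adm_scale.
  move=> y; rewrite -expRD ler_expR.
  have := FM x y; have := FM x' y; rewrite !ler_norml => /andP[? ?] /andP[? ?].
  lra.
rewrite mulr1 -[leRHS]expR0 ler_expR; lra.
Qed.

Lemma row_density_ge x x' y :
  expR (- (4 * M)) * expR (F x' y + a x' + b y) <= expR (F x y + a x + b y).
Proof.
rewrite -expRD ler_expR.
have := FM x y; have := FM x' y; rewrite !ler_norml => /andP[? ?] /andP[? ?].
have := row_potential_osc x' x; lra.
Qed.

(** The normalization of row x makes exp (a x - a' x) the average, up to a factor
    in the interval from exp (- eps) to exp eps, of exp (b' - b) under the row
    density at x; two such row densities are comparable, and averages contract
    oscillations. *)
Lemma row_potential_contract F' a' b' (eps D : R) :
  (forall x y, `|F x y - F' x y| <= eps) ->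
  (forall x, adm (F' x)) -> adm b' ->
  (forall x, I (fun y => expR (F' x y + a' x + b' y)) = 1) ->
  (forall y y', (b' y - b y) - (b' y' - b y') <= D) ->
  forall x x', (a' x - a x) - (a' x' - a x')
    <= 2 * eps + (1 - expR (- (4 * M))) * D.
Proof.
move=> FF' aF' ab' rows' oscb x x'.
pose h y := b' y - b y; pose w x := a' x - a x.
have ah : adm h by apply: (adm_add HI) => //; exact: adm_opp.
have M0 : 0 <= M by apply: le_trans (FM x x).
have d01 : 0 <= expR (- (4 * M)) <= 1.
  by rewrite expR_ge0 -[leRHS]expR0 ler_expR; lra.
have := avg_expR_contract (adm_row x) (adm_row x') ah d01
  (fun t => expR_ge0 _) (row_density_ge x x') (rows x) (rows x') oscb.
have key z : expR (- eps) * expR (- w z) <=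
    I (fun y => expR (F z y + a z + b y) * expR (h y)) /\
    I (fun y => expR (F z y + a z + b y) * expR (h y)) <=
    expR eps * expR (- w z).
  have az := adm_mul HI (adm_row z) (adm_exp HI ah).
  have az' : adm (fun y => expR (F' z y + a' z + b' y)).
    apply: (adm_exp HI); apply: (adm_add HI) => //.
    by apply: (adm_add HI) => //; exact: adm_cst HI _.
  split.
    rewrite -[X in X <= _]mulr1 -[X in _ * X <= _](rows' z) -(avgZ HI)//.
    apply: avg_le => //; first exact: adm_scale.
    move=> y; rewrite -!expRD ler_expR /w /h.
    by have := FF' z y; rewrite ler_norml => /andP[? ?]; lra.
  rewrite -[X in _ <= X]mulr1 -[X in _ <= _ * X](rows' z) -(avgZ HI)//.
  apply: avg_le => //; first exact: adm_scale.
  move=> y; rewrite -!expRD ler_expR /w /h.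
  by have := FF' z y; rewrite ler_norml => /andP[? ?]; lra.
have [_ kx] := key x; have [kx' _] := key x'.
move=> /(le_trans kx') /le_trans - /(_ _ (ler_wpM2l (expR_ge0 _) kx)).
by rewrite -!expRD ler_expR /w; lra.
Qed.

End Rows.

(** The Schroedinger system of the kernel exp F, written for the logarithm l of
    the density of its solution. *)
Definition schrodinger (F l : T -> T -> R) : Prop :=
  [/\ forall x, I (fun y => expR (l x y)) = 1,
      forall y, I (fun x => expR (l x y)) = 1 &
      exists a b, [/\ adm a, adm b & forall x y, l x y = F x y + a x + b y]].

(** Let D be the supremum of the oscillations of b' - b. Applying the contraction for
    rows and then for columns gives D <= 2 eps + (1 - d) (2 eps + (1 - d) D),
    that is d D <= 2 eps; the additive constant in the potentials is then fixed
    by the normalization. *)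
Lemma schrodinger_stable F F' l l' (M eps : R) :
  (forall x y, `|F x y| <= M) ->
  (forall x, adm (F x)) -> (forall y, adm (F ^~ y)) ->
  (forall x, adm (F' x)) -> (forall y, adm (F' ^~ y)) ->
  (forall x y, `|F x y - F' x y| <= eps) ->
  schrodinger F l -> schrodinger F' l' ->
  forall x y, `|l x y - l' x y| <= (2 * expR (4 * M) + 2) * eps.
Proof.
move=> FM aF1 aF2 aF1' aF2' FF' [r c [a [b [aa ab lE]]]]
  [r' c' [a' [b' [aa' ab' lE']]]] x0 y0.
have {lE} lE : l = fun x y => F x y + a x + b y by do 2 apply/funext => ?.
have {lE'} lE' : l' = fun x y => F' x y + a' x + b' y by do 2 apply/funext => ?.
subst l l'.
have FM' x y : `|F' x y| <= M + eps.
  rewrite -(subrK (F x y) (F' x y)) addrC (le_trans (ler_normD _ _))// lerD//.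
  by rewrite distrC.
have swap G (u v : T -> R) (y : T) : I (fun x => expR (G x y + u x + v y)) = 1 ->
   I (fun x => expR (G x y + v y + u x)) = 1.
  by move=> <-; congr I; apply/funext => z; congr expR; ring.
have cs y := swap F a b y (c y).
have cs' y := swap F' a' b' y (c' y).
have M0 : 0 <= M by apply: le_trans (FM x0 x0).
have eps0 : 0 <= eps by apply: le_trans (FF' x0 x0).
set d := expR (- (4 * M)).
have d0 : 0 < d by exact: expR_gt0.
have d1 : d <= 1 by rewrite /d -[leRHS]expR0 ler_expR; lra.
pose P D := forall y y', (b' y - b y) - (b' y' - b y') <= D.
have step D : P D -> P (2 * eps + (1 - d) * (2 * eps + (1 - d) * D)).
  move=> PD.
  have oscw := row_potential_contract FM aF1 ab r FF' aF1' ab' r' PD.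
  exact: (@row_potential_contract (fun y x => F x y) b a M
    (fun _ _ => FM _ _) aF2 aa cs (fun y x => F' x y) b' a' eps _
    (fun _ _ => FF' _ _) aF2' aa' cs' oscw).
(* The a priori bound on the potentials makes the supremum finite. *)
pose S := [set z | exists y y', z = (b' y - b y) - (b' y' - b y')].
have supS : has_sup S.
  split; first by exists 0, y0, y0; rewrite subrr.
  exists (2 * M + 2 * (M + eps)) => _ [y [y' ->]].
  have := @row_potential_osc (fun y x => F x y) b a M _ aF2 aa cs y' y.
  have := @row_potential_osc (fun y x => F' x y) b' a' (M + eps) _ aF2' aa' cs' y y'.
  by move=> /(_ (fun _ _ => FM' _ _)) ? /(_ (fun _ _ => FM _ _)) ?; lra.
have PS : P (sup S).
  by move=> y y'; apply: ub_le_sup; [case: supS | exists y, y'].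
have : sup S <= 2 * eps + (1 - d) * (2 * eps + (1 - d) * sup S).
  by apply: ge_sup; [case: supS | move=> _ [y [y' ->]]; exact: step].
set D := sup S in PS * => DD.
have {DD} DD : D <= 2 * eps * expR (4 * M).
  have : (d * (2 - d)) * D <= (d * (2 - d)) * (2 * eps * expR (4 * M)).
    have -> : d * (2 - d) * (2 * eps * expR (4 * M)) = 
      (d * expR (4 * M)) * (2 - d) * 2 * eps by ring.
    have -> : d * expR (4 * M) = 1 by rewrite /d -expRD addNr expR0.
    by lra.
  by rewrite ler_pM2l// mulr_gt0//; lra.
set h := fun y => b' y - b y in PS *; set w := a' x0 - a x0.
have rx := r x0; have rx' := r' x0.
have arx : adm (fun y => expR (F x0 y + a x0 + b y)).
  apply: (adm_exp HI); apply: (adm_add HI) => //.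
  by apply: (adm_add HI) => //; exact: adm_cst HI _.
have arx' : adm (fun y => expR (F' x0 y + a' x0 + b' y)).
  apply: (adm_exp HI); apply: (adm_add HI) => //.
  by apply: (adm_add HI) => //; exact: adm_cst HI _.
(* As the rows of both solutions have mass one, w + h takes values of both signs
   up to eps; hence it is bounded by its oscillation plus eps. *)
have up : w + h y0 <= D + eps.
  have : expR (w + h y0 - D - eps) * 1 <= 1.
    rewrite -[X in _ * X]rx -[leRHS]rx' -(avgZ HI)//.
    apply: avg_le => //; first exact: adm_scale.
    move=> y; rewrite -!expRD ler_expR /w.
    have := FF' x0 y; have := PS y0 y.
    by rewrite /h ler_norml => ? /andP[? ?]; lra.
  by rewrite mulr1 -[leRHS]expR0 ler_expR; lra.
have dn : - (D + eps) <= w + h y0.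
  have : 1 <= expR (w + h y0 + D + eps) * 1.
    rewrite -[X in _ * X]rx -[leLHS]rx' -(avgZ HI)//.
    apply: avg_le => //; first exact: adm_scale.
    move=> y; rewrite -!expRD ler_expR /w.
    have := FF' x0 y; have := PS y y0.
    by rewrite /h ler_norml => ? /andP[? ?]; lra.
  by rewrite mulr1 -[leLHS]expR0 ler_expR; lra.
have := FF' x0 y0; move: up dn; rewrite /h /w !ler_norml => ? ? /andP[? ?].
by apply/andP; split; lra.
Qed.

End Contraction.

(** * Convergence of the Sinkhorn iteration *)

Lemma cvg_of_geometric_steps (R : realType) (u : R^nat) (D q : R) :
  0 <= q < 1 -> (forall m, `|u m.+1 - u m| <= D * q ^+ m) -> cvgn u.
Proof.
move=> /andP[q0 q1] uq.
have D0 : 0 <= D.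
  by have := uq 0%N; rewrite expr0 mulr1; apply: le_trans.
have c : cvgn (series (telescope u)).
  apply: normed_cvg; apply: (@series_le_cvg _ _ (geometric D q)) => [n|n|n|].
  - exact: normr_ge0.
  - exact: geometric_ge0.
  - exact: uq.
  - by apply: is_cvg_geometric_series; rewrite ger0_norm.
have -> : u = (fun=> u 0%N) \+ series (telescope u).
  by apply/funext => n; exact: eq_sum_telescope.
by apply: is_cvgD => //; exact: is_cvg_cst.
Qed.

Lemma cvg_norm_le (R : realType) (T : Type) (F : set_system T)
    (FF : Filter F) (u v : T -> R) (l : R) :
  (\forall x \near F, `|l - u x| <= v x) -> v @ F --> 0 -> u @ F --> l.
Proof.
move=> uv /cvgr0Pnorm_le v0; apply/cvgrPdist_le => e e0.
apply: filterS2 uv (v0 e e0) => x /le_trans h1 h2; apply: h1.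
exact: le_trans (ler_norm _) h2.
Qed.

Lemma cvg_mx (R : realType) (T : Type) (F : set_system T) (FF : Filter F)
    (k l : nat) (M : T -> 'M[R]_(k, l)) (A : 'M[R]_(k, l)) :
  (forall i j, M x i j @[x --> F] --> A i j) -> M x @[x --> F] --> A.
Proof.
move=> MA B [P PA PB].
have : \forall x \near F, forall i j, P i j (M x i j).
  apply: filter_forall => i; apply: filter_forall => j.
  exact: MA (PA i j).
by apply: filterS => x Px; exact: PB.
Qed.

Lemma cvg_sum (R : realType) (T J : Type) (F : set_system T) (FF : Filter F)
    (r : seq J) (u : T -> J -> R) (l : J -> R) :
  (forall j, u x j @[x --> F] --> l j) ->
  \sum_(j <- r) u x j @[x --> F] --> \sum_(j <- r) l j.
Proof.
move=> ul; elim: r => [|j r IH].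
  by rewrite big_nil; under eq_fun do rewrite big_nil; exact: cvg_cst.
by rewrite big_cons; under eq_fun do rewrite big_cons; exact: cvgD.
Qed.

Section Finite.
Variables (R : realType) (n : nat).
Local Notation k := n.+1.
Implicit Types (C : 'M[R]_k) (G : 'I_k -> 'I_k -> R).

Definition mean (u : 'I_k -> R) : R := k%:R^-1 * \sum_s u s.

Lemma averaging_mean : averaging setT mean.
Proof.
split=> //.
- by move=> u v _ _; rewrite /mean big_split/= mulrDr.
- by move=> c u _; rewrite /mean -mulr_sumr mulrCA.
- by move=> u _ u0; rewrite mulr_ge0// sumr_ge0.
- by rewrite /mean sumr_const card_ord mulVf.
Qed.

Definition row_log C (r : 'I_k) : R := - ln (k%:R * \sum_s C r s).

(** Up to transposition, every step of the iteration is the same map. *)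
Definition tscale C : 'M[R]_k := (row_scale C)^T.

Definition scaling G C :=
  exists a b, forall r s, C r s = expR (G r s + a r + b s).

Lemma scaling_gt0 G C r s : scaling G C -> 0 < C r s.
Proof. by move=> [a [b ->]]; exact: expR_gt0. Qed.

Lemma row_sum_gt0 C r : (forall r s, 0 < C r s) -> 0 < k%:R * \sum_s C r s.
Proof.
move=> C0; rewrite mulr_gt0 ?ltr0n//; rewrite big_ord_recl ltr_pwDl//.
by apply: sumr_ge0 => s _; exact: ltW.
Qed.

Lemma expR_row_log C r : (forall r s, 0 < C r s) ->
  expR (- row_log C r) = k%:R * \sum_s C r s.
Proof. by move=> C0; rewrite opprK lnK// posrE; exact: row_sum_gt0. Qed.

Lemma tscaleE C r s : (forall r s, 0 < C r s) ->
  tscale C s r = C r s * expR (row_log C r).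
Proof.
by move=> C0; rewrite /tscale mxE /row_scale mxE -[row_log C r]opprK expRN expR_row_log.
Qed.

Lemma tscale_col_sum C r : (forall r s, 0 < C r s) ->
  \sum_s tscale C s r = k%:R^-1.
Proof.
move=> C0; under eq_bigr do rewrite /tscale mxE /row_scale mxE.
have := lt0r_neq0 (row_sum_gt0 r C0); rewrite mulf_eq0 negb_or => /andP[_ S0].
by rewrite -mulr_suml invfM mulrCA divff ?mulr1.
Qed.

Lemma scaling_tscale G C : scaling G C -> scaling (fun s r => G r s) (tscale C).
Proof.
move=> GC; have C0 r s := scaling_gt0 r s GC; case: GC => a [b CE].
exists b, (fun r => a r + row_log C r) => s r.
by rewrite tscaleE// CE -expRD; congr expR; ring.
Qed.

(** The new factors are averages of the old ones under the normalized columns,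
    which are comparable densities by row_density_ge. *)
Lemma row_log_contract G C (M D : R) : scaling G C ->
  (forall r s, `|G r s| <= M) ->
  (forall s, \sum_r C r s = k%:R^-1) ->
  (forall r r', row_log C r - row_log C r' <= D) ->
  forall s s', row_log (tscale C) s - row_log (tscale C) s'
    <= (1 - expR (- (4 * M))) * D.
Proof.
move=> GC GM colC osc s s'.
have C0 r t := scaling_gt0 r t GC.
have C'0 r t := scaling_gt0 r t (scaling_tscale GC).
have [a [b CE]] := GC.
pose p (t r : 'I_k) := k%:R ^+ 2 * C r t.
pose b' r := a r + ln (k%:R ^+ 2).
have k0 : 0 < k%:R :> R by rewrite ltr0n.
have k20 : 0 < k%:R ^+ 2 :> R by rewrite exprn_gt0.
have pE t r : p t r = expR (G r t + b t + b' r).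
  rewrite /p CE -[X in X * _]lnK ?posrE// -expRD; congr expR; rewrite /b'; ring.
have mp t : mean (p t) = 1.
  rewrite /mean -mulr_sumr colC expr2 -mulrA mulfV ?gt_eqF//.
  by rewrite mulr1 mulVf// gt_eqF.
have key t : expR (- row_log (tscale C) t) =
    mean (fun r => p t r * expR (row_log C r)).
  rewrite expR_row_log// /mean /p.
  under [in RHS]eq_bigr do rewrite -mulrA -tscaleE//.
  by rewrite -mulr_sumr mulrA expr2 mulrA mulVf ?gt_eqF// mul1r.
have M0 : 0 <= M by apply: le_trans (GM s s).
have d01 : 0 <= expR (- (4 * M)) <= 1.
  by rewrite expR_ge0 -[leRHS]expR0 ler_expR; lra.
have rowsp t : mean (fun r => expR (G r t + b t + b' r)) = 1.
  by rewrite -[RHS](mp t); congr mean; apply/funext => r; rewrite pE.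
have dens r : expR (- (4 * M)) * p s' r <= p s r.
  by rewrite !pE; apply: (row_density_ge averaging_mean
    (F := fun t r => G r t) (a := b) (b := b') (fun _ _ => GM _ _)).
have p0 r : 0 <= p s' r by rewrite pE expR_ge0.
have := avg_expR_contract averaging_mean (p := p s) (p' := p s') I I I d01 p0
  dens (mp _) (mp _) osc.
by rewrite -!key -expRD ler_expR; lra.
Qed.

(** Column normalization makes the mean of exp (- row_log C) equal to 1, so that
    row_log C cannot keep a strict sign: its size is at most its oscillation. *)
Lemma row_log_bound C (D : R) : (forall r s, 0 < C r s) ->
  (forall s, \sum_r C r s = k%:R^-1) ->
  (forall r r', row_log C r - row_log C r' <= D) ->
  forall r, `|row_log C r| <= D.
Proof.
move=> C0 colC osc r.
have k0 : 0 < k%:R :> R by rewrite ltr0n.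
have m1 : mean (fun r => expR (- row_log C r)) = 1.
  rewrite /mean; under eq_bigr do rewrite expR_row_log//.
  rewrite -mulr_sumr mulrA mulVf ?gt_eqF// mul1r exchange_big/=.
  under eq_bigr do rewrite colC.
  by rewrite sumr_const card_ord -[_ *+ _]mulr_natl divff// gt_eqF.
have up : expR (- row_log C r - D) <= 1.
  rewrite -m1 -[leLHS]mulr1 -(avg1 averaging_mean) -(avgZ averaging_mean)//.
  apply: (avg_le averaging_mean) => // r'.
  by rewrite mulr1 ler_expR; have := osc r' r; lra.
have dn : 1 <= expR (- row_log C r + D).
  rewrite -m1 -[leRHS]mulr1 -(avg1 averaging_mean) -(avgZ averaging_mean)//.
  apply: (avg_le averaging_mean) => // r'.
  by rewrite mulr1 ler_expR; have := osc r r'; lra.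
move: up dn; rewrite -[in X in X -> _]expR0 -[in X in _ -> X -> _]expR0 !ler_expR.
by rewrite ler_norml => ? ?; apply/andP; split; lra.
Qed.

End Finite.

Section Sinkhorn.
Variables (R : realType) (n : nat) (f : R * R -> R) (theta : R).
Local Notation k := n.+1.

Definition gridf (r s : 'I_k) : R := theta * f (grid R r s).
Local Notation B := (sinkhorn k f theta).
Let C m : 'M[R]_k := iter m (@tscale R n) (B 0%N).

Lemma col_scaleE (D : 'M[R]_k) : col_scale D = tscale D^T.
Proof.
apply/matrixP => r s; rewrite /tscale /col_scale /row_scale !mxE.
by congr (_ / (_ * _)); apply: eq_bigr => l _; rewrite mxE.
Qed.

Lemma sinkhornE m : B m = if odd m then (C m)^T else C m.
Proof.
elim: m => // m IH; rewrite /= IH; case: (odd m) => /=.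
  by rewrite col_scaleE trmxK.
by rewrite /tscale trmxK.
Qed.

Lemma scaling_iter m :
  scaling (if odd m then fun r s => gridf s r else gridf) (C m).
Proof.
elim: m => [|m IH] /=.
  exists (fun=> 0), (fun=> 0) => r s.
  by rewrite /C /= mxE !addr0.
by have := scaling_tscale IH; case: (odd m).
Qed.

Lemma iter_gt0 m r s : 0 < C m r s.
Proof. exact: scaling_gt0 (scaling_iter m). Qed.

Lemma sinkhorn_gt0 m r s : 0 < B m r s.
Proof. by rewrite sinkhornE; case: ifP => _; rewrite ?mxE iter_gt0. Qed.

Lemma iter_col_sum m s : \sum_r C m.+1 r s = k%:R^-1.
Proof. exact: tscale_col_sum (iter_gt0 m). Qed.

Lemma sinkhorn_row_sum m r : odd m -> \sum_s B m r s = k%:R^-1.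
Proof.
case: m => // m om; rewrite sinkhornE om -(iter_col_sum m r).
by apply: eq_bigr => s _; rewrite mxE.
Qed.

Lemma sinkhorn_col_sum m s : ~~ odd m.+1 -> \sum_r B m.+1 r s = k%:R^-1.
Proof. by move=> /negbTE om; rewrite sinkhornE om -(iter_col_sum m s). Qed.

(** Expressing separability by the values at ord0, rather than by the existence
    of potentials, lets it pass to the limit. *)
Lemma sinkhorn_separable m r s :
  ln (B m r s) - gridf r s = ln (B m r ord0) - gridf r ord0
    + (ln (B m ord0 s) - gridf ord0 s)
    - (ln (B m ord0 ord0) - gridf ord0 ord0).
Proof.
have [a [b BE]] : scaling gridf (B m).
  have := scaling_iter m; rewrite sinkhornE; case: (odd m) => //.
  by move=> [a [b CE]]; exists b, a => x y; rewrite mxE CE; congr expR; ring.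
by rewrite !BE !expRK; ring.
Qed.

(** The oscillation of the logarithms of the factors is multiplied by at most
    1 - d at each step, and it bounds their size since the previous step has
    normalized the columns or the rows. *)
Lemma ln_sinkhorn_steps : exists D q : R, 0 <= q < 1 /\
  forall m r s, `|ln (B m.+2 r s) - ln (B m.+1 r s)| <= D * q ^+ m.
Proof.
pose M : R := \sum_r \sum_s `|gridf r s|.
have GM r s : `|gridf r s| <= M.
  rewrite /M (bigD1 r)//= (bigD1 s)//= -addrA lerDl addr_ge0 ?sumr_ge0// => i _.
  by rewrite sumr_ge0.
pose D : R := \sum_r \sum_r' `|row_log (C 1) r - row_log (C 1) r'|.
have D1 r r' : row_log (C 1) r - row_log (C 1) r' <= D.
  rewrite (le_trans (ler_norm _))// /D (bigD1 r)//= (bigD1 r')//= -addrA lerDl.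
  by rewrite addr_ge0 ?sumr_ge0// => i _; rewrite sumr_ge0.
exists D, (1 - expR (- (4 * M))); split.
  have M0 : 0 <= M by apply: le_trans (GM ord0 ord0).
  rewrite subr_ge0 gtrBl expR_gt0 andbT -[leRHS]expR0 ler_expR; lra.
set q := 1 - _ => m.
have osc : forall r r', row_log (C m.+1) r - row_log (C m.+1) r' <= D * q ^+ m.
  elim: m => [|m IH]; first by move=> r r'; rewrite expr0 mulr1.
  move=> r r'; rewrite exprS mulrCA.
  apply: (row_log_contract (scaling_iter m.+1) _ (iter_col_sum m) IH).
  by move=> i j; case: (odd m.+1); apply: GM.
have bnd := row_log_bound (iter_gt0 m.+1) (iter_col_sum m) osc.
have lnC r s : ln (C m.+2 s r) = ln (C m.+1 r s) + row_log (C m.+1) r.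
  have -> : C m.+2 = tscale (C m.+1) by [].
  rewrite (tscaleE r s (iter_gt0 m.+1)).
  by rewrite lnM ?posrE ?expR_gt0 ?iter_gt0// expRK.
move=> r s; rewrite [B m.+2]sinkhornE [B m.+1]sinkhornE [odd m.+1]/=.
set X := C m.+2 in lnC *; set Y := C m.+1 in lnC bnd *; clearbody X Y.
rewrite [odd m.+2]/= negbK.
by case: (odd m) => /=; rewrite mxE lnC addrAC subrr add0r; exact: bnd.
Qed.

(** Row sums are exact after odd steps and column sums after even ones, so that
    the limit has both; separability passes to the limit too. *)
Lemma sinkhorn_limit : exists A l, [/\ B m @[m --> \oo] --> A, Mk A,
  schrodinger setT (@mean R n) gridf l &
  forall r s, A r s = k%:R ^- 2 * expR (l r s)].
Proof.
have [D [q [q01 steps]]] := ln_sinkhorn_steps.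
have cL r s : ln (B m r s) @[m --> \oo] -->
    limn (fun m => ln (B m.+1 r s)).
  rewrite -cvg_shiftS; apply: (@cvg_of_geometric_steps _ _ D q q01) => m.
  exact: steps.
set L := fun r s => limn (fun m => ln (B m.+1 r s)).
have k0 : 0 < k%:R :> R by rewrite ltr0n.
have cB r s : B m r s @[m --> \oo] --> expR (L r s).
  under eq_fun do rewrite -[B _ r s]lnK ?posrE ?sinkhorn_gt0//.
  by apply: continuous_cvg; [exact: continuous_expR | exact: cL].
have oddn : (fun m => m.*2.+1) @ \oo --> \oo.
  move=> P [N _ NP]; exists N => //= m Nm; apply: NP => /=.
  by rewrite (leq_trans Nm)// -addnn -addSn leq_addl.
have evenn : (fun m => m.*2.+2) @ \oo --> \oo.
  move=> P [N _ NP]; exists N => //= m Nm; apply: NP => /=.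
  by rewrite (leq_trans Nm)// -addnn -addSn -addSn leq_addl.
have rowL r : \sum_s expR (L r s) = k%:R^-1.
  have : \sum_s B m.*2.+1 r s @[m --> \oo] --> \sum_s expR (L r s).
    by apply: cvg_sum => s; exact: (cvg_comp _ _ oddn (cB r s)).
  under eq_fun do rewrite sinkhorn_row_sum ?oddS ?odd_double//.
  by move/(cvg_unique (@Rhausdorff R)) => /(_ _ (cvg_cst _)).
have colL s : \sum_r expR (L r s) = k%:R^-1.
  have : \sum_r B m.*2.+2 r s @[m --> \oo] --> \sum_r expR (L r s).
    by apply: cvg_sum => r; exact: (cvg_comp _ _ evenn (cB r s)).
  under eq_fun do rewrite sinkhorn_col_sum /= ?negbK ?odd_double//.
  by move/(cvg_unique (@Rhausdorff R)) => /(_ _ (cvg_cst _)).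
have sepL r s : L r s - gridf r s = L r ord0 - gridf r ord0
    + (L ord0 s - gridf ord0 s) - (L ord0 ord0 - gridf ord0 ord0).
  have c0 i j : ln (B m i j) - gridf i j @[m --> \oo] --> L i j - gridf i j.
    by apply: cvgB; [exact: cL | exact: cvg_cst].
  have := c0 r s; under eq_fun do rewrite sinkhorn_separable.
  move/(cvg_unique (@Rhausdorff R)); apply.
  by apply: cvgB (c0 _ _); exact: cvgD (c0 _ _) (c0 _ _).
(* Entries of matrices in Mk have mean k^-2, densities have mean 1. *)
pose l r s := ln (k%:R ^+ 2) + L r s.
have lE r s : expR (l r s) = k%:R ^+ 2 * expR (L r s).
  by rewrite expRD lnK// posrE exprn_gt0.
have kk : k%:R^-1 * (k%:R ^+ 2 * k%:R^-1) = 1 :> R.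
  by rewrite expr2 -mulrA mulfV ?gt_eqF// mulr1 mulVf// gt_eqF.
exists (\matrix_(r, s) expR (L r s)), l; split.
- by apply: cvg_mx => r s; rewrite mxE; exact: cB.
- split => [r s|r|s]; first by rewrite mxE expR_ge0.
    by rewrite -(rowL r); apply: eq_bigr => s _; rewrite mxE.
  by rewrite -(colL s); apply: eq_bigr => r _; rewrite mxE.
- split => [r|s|].
  + by rewrite /mean; under eq_bigr do rewrite lE; rewrite -mulr_sumr rowL kk.
  + by rewrite /mean; under eq_bigr do rewrite lE; rewrite -mulr_sumr colL kk.
  + exists (fun r => ln (k%:R ^+ 2) + L r ord0 - gridf r ord0).
    exists (fun s => L ord0 s - gridf ord0 s - (L ord0 ord0 - gridf ord0 ord0)).
    by split=> // r s; rewrite /l; have := sepL r s; lra.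
- by move=> r s; rewrite lE mulKf ?mxE// gt_eqF// exprn_gt0.
Qed.

End Sinkhorn.

(** * The discrete variational problem *)

(** The inequality 1 + t <= exp t at t = ln y - ln x. *)
Lemma gibbs_le (R : realType) (x y : R) : 0 <= x -> 0 < y ->
  x - y <= x * (ln x - ln y).
Proof.
rewrite le_eqVlt => /predU1P[<-|x0] y0; first by rewrite mul0r; lra.
have := expR_ge1Dx (ln y - ln x).
rewrite expRB !lnK ?posrE// -(ler_pM2l x0) mulrCA divff ?gt_eqF//.
by lra.
Qed.

Lemma gibbs_eq (R : realType) (x y : R) : 0 <= x -> 0 < y ->
  x * (ln x - ln y) = x - y -> x = y.
Proof.
rewrite le_eqVlt => /predU1P[<-|x0] y0; first by rewrite mul0r; lra.
move=> E; apply/eqP/negPn/negP => xy.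
have : ln y - ln x != 0.
  by rewrite subr_eq0; apply/negP => /eqP/ln_inj e; move/eqP: xy; rewrite e.
move=> /expR_gt1Dx.
rewrite expRB !lnK ?posrE// -(ltr_pM2l x0) mulrCA divff ?gt_eqF//.
by lra.
Qed.

Section Discrete.
Variables (R : realType) (n : nat) (f : R * R -> R).
Local Notation k := n.+1.
Implicit Types (A B : 'M[R]_k).

(** The factor k^-2 makes exp l a density with respect to the uniform matrix, as
    in the continuous problem. *)
Definition optimal theta A l := [/\ Mk A,
  schrodinger setT (@mean R n) (gridf f theta) l &
  forall r s, A r s = k%:R ^- 2 * expR (l r s)].

Definition obs B : R := \sum_r \sum_s B r s * f (grid R r s).

Definition rel_entropy B A : R :=
  \sum_r \sum_s B r s * (ln (B r s) - ln (A r s)).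

Let k0 : 0 < k%:R :> R. Proof. by rewrite ltr0n. Qed.

Lemma optimal_gt0 theta A l r s : optimal theta A l -> 0 < A r s.
Proof. by move=> [_ _ ->]; rewrite mulr_gt0 ?expR_gt0// invr_gt0 exprn_gt0. Qed.

Lemma Mk_sum_row B (a : 'I_k -> R) : Mk B ->
  \sum_r \sum_s B r s * a r = mean a.
Proof.
move=> [_ Br _]; rewrite /mean mulr_sumr; apply: eq_bigr => r _.
by rewrite -mulr_suml Br.
Qed.

Lemma Mk_sum_col B (b : 'I_k -> R) : Mk B ->
  \sum_r \sum_s B r s * b s = mean b.
Proof.
move=> [_ _ Bc]; rewrite exchange_big /mean mulr_sumr; apply: eq_bigr => s _.
by rewrite -mulr_suml Bc.
Qed.

Lemma Mk_sum_cst B (c : R) : Mk B -> \sum_r \sum_s B r s * c = c.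
Proof.
move=> MB; rewrite (Mk_sum_row (fun=> c) MB) /mean sumr_const card_ord.
by rewrite -[c *+ _]mulr_natl mulKf// gt_eqF.
Qed.

(** The marginal constraints turn the separable part of ln A into a constant:
    up to that constant the objective is minus the relative entropy with
    respect to A. *)
Lemma objkE theta A l B : optimal theta A l -> Mk B ->
  objk f theta B =
  - mean (fun r => mean (fun s => l r s - gridf f theta r s))
  - rel_entropy B A.
Proof.
move=> [_ [_ _ [a [b [_ _ lE]]]] AE] MB.
have lnA r s : ln (A r s) = gridf f theta r s + a r + b s - 2 * ln k%:R.
  rewrite AE lE lnM ?posrE ?expR_gt0 ?invr_gt0 ?exprn_gt0//.
  by rewrite expRK lnV ?posrE ?exprn_gt0// lnXn// -mulr_natl; ring.
have -> : mean (fun r => mean (fun s => l r s - gridf f theta r s))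
    = mean a + mean b.
  have -> : (fun r => mean (fun s => l r s - gridf f theta r s))
      = fun r => a r + mean b.
    apply/funext => r; transitivity (mean (fun s => a r * 1 + b s)).
      by congr mean; apply/funext => s; rewrite lE; ring.
    rewrite (avgD (averaging_mean R n))// (avgZ (averaging_mean R n))//.
    by rewrite (avg1 (averaging_mean R n)) mulr1.
  rewrite (avgD (averaging_mean R n))//; congr (_ + _).
  rewrite -[X in mean (fun=> X)]mulr1 (avgZ (averaging_mean R n))//.
  by rewrite (avg1 (averaging_mean R n)) mulr1.
rewrite -(Mk_sum_row a MB) -(Mk_sum_col b MB) /rel_entropy /objk.
rewrite -[X in _ - X - _](Mk_sum_cst (2 * ln k%:R) MB).
rewrite mulr_sumr opprD -!sumrN -!big_split/=; apply: eq_bigr => r _.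
rewrite mulr_sumr -!sumrN -!big_split/=.
by apply: eq_bigr => s _; rewrite lnA /gridf; ring.
Qed.

Lemma rel_entropy_ge0 A B : Mk A -> Mk B -> (forall r s, 0 < A r s) ->
  0 <= rel_entropy B A /\ (rel_entropy B A = 0 -> B = A).
Proof.
move=> MA MB A0; have [B0 _ _] := MB.
have E : rel_entropy B A =
  \sum_r \sum_s (B r s * (ln (B r s) - ln (A r s)) - (B r s - A r s)).
  transitivity (rel_entropy B A - (\sum_r \sum_s B r s * 1 -
      \sum_r \sum_s A r s * 1)).
    by rewrite !Mk_sum_cst// subrr subr0.
  rewrite opprB -!sumrN -!big_split; apply: eq_bigr => r _ /=.
  rewrite -!sumrN -!big_split; apply: eq_bigr => s _ /=.
  by rewrite !mulr1 opprB.
have pos r s : 0 <= B r s * (ln (B r s) - ln (A r s)) - (B r s - A r s).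
  by rewrite subr_ge0 gibbs_le.
split; first by rewrite E; apply: sumr_ge0 => r _; exact: sumr_ge0.
rewrite E => /eqP; rewrite psumr_eq0 => [/allP h|r _]; last exact: sumr_ge0.
apply/matrixP => r s.
have := h r (mem_index_enum _); rewrite psumr_eq0// => /allP /(_ s).
move=> /(_ (mem_index_enum _)); rewrite subr_eq0 => /eqP.
exact: gibbs_eq.
Qed.

Lemma argmax_objk theta A l : optimal theta A l ->
  argmax (@Mk R k) (objk f theta) = [set A].
Proof.
move=> oA; have [MA _ _] := oA; have A0 r s := optimal_gt0 r s oA.
have AA : rel_entropy A A = 0.
  by rewrite /rel_entropy big1// => r _; rewrite big1// => s _; rewrite subrr mulr0.
have le B : Mk B -> objk f theta B <= objk f theta A.
  move=> MB; rewrite !(objkE oA)// AA subr0 gerBl.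
  by have [] := rel_entropy_ge0 MA MB A0.
apply/seteqP; split => [B [MB maxB]|_ ->]; last by split.
have [ge0 eq0] := rel_entropy_ge0 MA MB A0; apply: eq0.
apply/le_anti/andP; split => //.
by have := maxB A MA; rewrite !(objkE oA)// AA; lra.
Qed.

Lemma W_ge theta A l B : optimal theta A l -> Mk B ->
  objk f theta B <= W k f theta.
Proof.
move=> oA MB; apply: ub_le_sup; last by exists B.
have := argmax_objk oA => E; have [_ maxA] : argmax (@Mk R k) (objk f theta) A.
  by rewrite E.
by exists (objk f theta A) => _ [B' MB' <-]; exact: maxA.
Qed.

Lemma W_attained theta A l : optimal theta A l -> W k f theta = objk f theta A.
Proof.
move=> oA; have [MA _ _] := oA; apply/le_anti/andP; split; last exact: W_ge oA _.
have := argmax_objk oA => E; have [_ maxA] : argmax (@Mk R k) (objk f theta) A.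
  by rewrite E.
apply: ge_sup; first by exists (objk f theta A), A.
by move=> _ [B' MB' <-]; exact: maxA.
Qed.

Lemma W_mean theta A l : optimal theta A l -> W k f theta =
  - mean (fun r => mean (fun s => l r s - gridf f theta r s)).
Proof.
move=> oA; have [MA _ _] := oA; rewrite (W_attained oA) (objkE oA MA).
rewrite /rel_entropy big1 ?subr0// => r _.
by rewrite big1// => s _; rewrite subrr mulr0.
Qed.

Lemma objk_affine theta theta' B :
  objk f theta' B = objk f theta B + (theta' - theta) * obs B.
Proof.
have -> : obs B = \sum_r \sum_s f (grid R r s) * B r s.
  by apply: eq_bigr => r _; apply: eq_bigr => s _; rewrite mulrC.
by rewrite /objk; ring.
Qed.

Lemma optimal_exists theta : exists A l, optimal theta A l.
Proof. by have [A [l [_ MA sl AE]]] := sinkhorn_limit n f theta; exists A, l. Qed.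

Lemma W_convex : convex_function (E := R^o) setT (W k f).
Proof.
move=> t x y _ _; rewrite !convRE /unstable.onem.
have p0 : 0 <= t%:inum :> R by [].
have p1 : t%:inum <= 1 :> R by [].
set p := t%:inum in p0 p1 *.
have [A [l oA]] := optimal_exists (p * x + (1 - p) * y).
have [A1 [l1 oA1]] := optimal_exists x; have [A2 [l2 oA2]] := optimal_exists y.
have [MA _ _] := oA; rewrite (W_attained oA).
have := ler_wpM2l p0 (W_ge oA1 MA).
have := ler_wpM2l (_ : 0 <= 1 - p) (W_ge oA2 MA).
rewrite subr_ge0 => /(_ p1).
rewrite (objk_affine x y) (objk_affine x (p * x + (1 - p) * y)).
have -> : p * x + (1 - p) * y - x = (1 - p) * (y - x) by ring.
lra.
Qed.

(** Each of the two matrices competes in the problem that the other solves, and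
    the objective is affine in theta. *)
Lemma W_subgradient theta theta' A A' l l' :
  optimal theta A l -> optimal theta' A' l' ->
  (theta' - theta) * obs A <= W k f theta' - W k f theta <=
  (theta' - theta) * obs A'.
Proof.
move=> oA oA'; have [MA _ _] := oA; have [MA' _ _] := oA'.
have := W_ge oA' MA; have := W_ge oA MA'.
rewrite (W_attained oA) (W_attained oA') (objk_affine theta theta' A).
by rewrite (objk_affine theta theta' A'); lra.
Qed.

Section Family.
Variables (A : R -> 'M[R]_k) (l : R -> 'I_k -> 'I_k -> R).
Hypothesis oA : forall theta, optimal theta (A theta) (l theta).

(** By stability the log-densities are Lipschitz in theta near each point. *)
Lemma obs_continuous (theta : R) :
  obs (A t) @[t --> theta] --> obs (A theta).
Proof.
pose M : R := \sum_(r < k) \sum_(s < k) `|f (grid R r s)|.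
have fM (r s : 'I_k) : `|f (grid R r s)| <= M.
  rewrite /M (bigD1 r)//= (bigD1 s)//= -addrA lerDl addr_ge0 ?sumr_ge0// => i _.
  by rewrite sumr_ge0.
have cl r s : l t r s @[t --> theta] --> l theta r s.
  pose K := 2 * expR (4 * (`|theta| * M)) + 2.
  apply: (@cvg_norm_le _ _ _ _ _ (fun t => K * (`|theta - t| * M))).
    near=> t; have [_ st _] := oA t; have [_ s0 _] := oA theta.
    apply: (schrodinger_stable (averaging_mean R n) (F := gridf f theta)
      (F' := gridf f t)) => // x y; first by rewrite /gridf normrM ler_wpM2l.
    by rewrite /gridf -mulrBl normrM ler_wpM2l.
  rewrite [X in _ --> X](_ : 0 = K * (`|theta - theta| * M)); last first.
    by rewrite subrr normr0 mul0r mulr0.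
  apply: cvgMl_tmp; apply: cvgMr_tmp; apply: cvg_norm.
  by apply: cvgB; [exact: cvg_cst | exact: cvg_id].
apply: cvg_sum => r; apply: cvg_sum => s; apply: cvgMr_tmp.
have [_ _ ->] := oA theta.
under eq_fun => t do (have [_ _ ->] := oA t).
apply: cvgMl_tmp; apply: continuous_cvg; [exact: continuous_expR | exact: cl].
Unshelve. all: by end_near. Qed.

Lemma W_derivative (theta : R) :
  derivable (W k f) theta 1 /\ derive1 (W k f) theta = obs (A theta).
Proof.
have H : h^-1 *: (((W k f) \o shift theta) (h *: (1 : R)) - W k f theta)
    @[h --> 0^'] --> obs (A theta).
  have shift0 : (h + theta) @[h --> (0 : R)^'] --> theta.
    rewrite -[X in _ --> X]add0r; apply: cvgD; last exact: cvg_cst.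
    exact: nbhs_dnbhs.
  apply: (@cvg_norm_le _ _ _ _ _
    (fun h => `|obs (A theta) - obs (A (h + theta))|)).
    near=> h; rewrite /= [h%:A]mulr1.
    have h0 : h != 0 by near: h; exact: nbhs_dnbhs_neq.
    have := W_subgradient (oA theta) (oA (h + theta)); rewrite addrK.
    set w := W k f _ - _; set x := obs _; set y := obs _ => /andP[w1 w2].
    have wE : w = h * (h^-1 *: w) by rewrite /GRing.scale/= mulVKf.
    set q := h^-1 *: w in wE *; rewrite wE in w1 w2.
    have [hp|hn|hz] := ltgtP h 0; last by rewrite hz eqxx in h0.
      rewrite ler_nM2l// in w1; rewrite ler_nM2l// in w2.
      by rewrite !ger0_norm ?subr_ge0//; lra.
    rewrite ler_pM2l// in w1; rewrite ler_pM2l// in w2.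
    by rewrite !ler0_norm ?subr_le0//; lra.
  rewrite [X in _ --> X](_ : 0 = `|obs (A theta) - obs (A theta)|); last first.
    by rewrite subrr normr0.
  apply: cvg_norm.
  apply: cvgB; first exact: cvg_cst.
  apply: (cvg_comp (fun h => h + theta) (fun t => obs (A t)) shift0).
  exact: obs_continuous.
split; first by apply/cvg_ex; exists (obs (A theta)).
by rewrite derive1E; exact: cvg_lim H.
Unshelve. all: by end_near. Qed.

End Family.

Lemma objk_cvg theta A l (B : nat -> 'M[R]_k) : optimal theta A l ->
  B m @[m --> \oo] --> A ->
  objk f theta (B m) @[m --> \oo] --> W k f theta.
Proof.
move=> oA BA; rewrite (W_attained oA).
have cB r s : B m r s @[m --> \oo] --> A r s.
  exact: (cvg_comp _ _ BA (@coord_continuous _ _ _ r s A)).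
apply: cvgB; last first.
  apply: cvg_sum => r; apply: cvg_sum => s; apply: cvgM => //.
  by apply: continuous_cvg => //; exact: continuous_ln (optimal_gt0 r s oA).
apply: cvgB; last exact: cvg_cst.
by apply: cvgMl_tmp; apply: cvg_sum => r; apply: cvg_sum => s; exact: cvgMl_tmp.
Qed.

End Discrete.

(** * Bounded measurable functions and step functions *)

Section BoundedMeasurable.
Variables (d : measure_display) (T : measurableType d) (R : realType).

Definition bmeas : set (T -> R) :=
  [set u : T -> R | measurable_fun setT u /\ exists M : R, forall x, `|u x| <= M].

Lemma bmeas_integrable (P : probability T R) u :
  bmeas u -> P.-integrable setT (EFin \o u).
Proof.
move=> [mu [M uM]]; apply: measurable_bounded_integrable => //.
  by apply: le_lt_trans (ltry 1); exact: (@probability_le1 _ _ _ P).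
exists M; split; first by rewrite num_real.
by move=> x Mx y _; exact: le_trans (uM y) (ltW Mx).
Qed.

Lemma averaging_Rintegral (P : probability T R) :
  averaging bmeas (fun u => \int[P]_x u x).
Proof.
split.
- by move=> c; split; [exact: measurable_cst|exists `|c|].
- move=> u v [mu [M uM]] [mv [N vN]]; split; first exact: measurable_funD.
  exists (M + N) => x; exact: le_trans (ler_normD _ _) (lerD (uM x) (vN x)).
- move=> u v [mu [M uM]] [mv [N vN]]; split; first exact: measurable_funM.
  by exists (M * N) => x; rewrite normrM ler_pM.
- move=> u [mu [M uM]]; split; first exact: measurableT_comp.
  exists (expR M) => x; rewrite ger0_norm ?expR_ge0// ler_expR.
  exact: le_trans (ler_norm _) (uM x).
- by move=> u v bu bv; rewrite RintegralD//; exact: bmeas_integrable.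
- by move=> c u bu; rewrite RintegralZl//; exact: bmeas_integrable.
- by move=> u _ u0; apply: Rintegral_ge0 => x _; exact: u0.
- rewrite Rintegral_cst// mul1r.
  by have /(congr1 fine) := probability_setT P.
Qed.

Lemma bmeas_lim (u : (T -> R)^nat) (v : T -> R) :
  (forall m, bmeas (u m)) ->
  (forall e, 0 < e -> \forall m \near \oo, forall x, `|u m x - v x| <= e) ->
  bmeas v.
Proof.
move=> bu uv; split.
  apply: (measurable_fun_cvg (h := u)) => [m|x _]; first by have [] := bu m.
  apply/cvgrPdist_le => e e0; apply: filterS (uv e e0) => m /(_ x).
  by rewrite distrC.
have [m /= um] := filter_ex (uv 1 ltr01); have [_ [M uM]] := bu m.
exists (1 + M) => x; rewrite -[v x](subrK (u m x)).
by rewrite (le_trans (ler_normD _ _))// lerD// distrC.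
Qed.

End BoundedMeasurable.

Lemma avg_dist (R : realType) (T : Type) adm I (HI : @averaging R T adm I)
    u v (e : R) : adm u -> adm v ->
  (forall x, `|u x - v x| <= e) -> `|I u - I v| <= e.
Proof.
move=> au av uv.
have ce : I (fun=> e) = e.
  rewrite -[X in I (fun=> X)]mulr1 (avgZ HI) ?(avg1 HI) ?mulr1//.
  exact: adm_cst HI 1.
have half w z : adm w -> adm z -> (forall x, `|w x - z x| <= e) -> I w - I z <= e.
  move=> aw az wz; rewrite lerBlDl -[X in _ + X]ce -(avgD HI)//; last first.
    exact: adm_cst HI e.
  apply: (avg_le HI) => // [|x]; first exact: (adm_add HI az (adm_cst HI e)).
  by have := wz x; rewrite ler_norml => /andP[_]; rewrite lerBlDl.
by rewrite ler_norml lerNl opprB; apply/andP; split; apply: half => // x;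
  rewrite distrC.
Qed.

Section Cells.
Variables (R : realType) (n : nat).
Local Notation k := n.+1.
Local Notation P := (unif1 R).

(** Points outside of [0,1] are sent to the extreme cells, so that step functions
    are defined, and the equations that they satisfy hold, on the whole line. *)
Definition cell (x : R) : 'I_k := inord (minn (Num.truncn (k%:R * x)) n).

Let k0 : 0 < k%:R :> R. Proof. by rewrite ltr0n. Qed.

Lemma val_cell x : cell x = minn (Num.truncn (k%:R * x)) n :> nat.
Proof. by rewrite inordK// ltnS geq_minr. Qed.

Lemma cell_ge x (j : nat) :
  (j <= cell x)%N = (j == 0)%N || ((j <= n)%N && (j%:R / k%:R <= x)).
Proof.
rewrite val_cell leq_min andbC; case: j => [|j]; first by rewrite leq0n.
by rewrite truncn_gt_nat ler_pdivrMr// mulrC.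
Qed.

Lemma unif1_itvcy (c : R) : 0 <= c <= 1 -> P `[c, +oo[%classic = (1 - c)%:E.
Proof.
move=> /andP[c0 c1]; rewrite /= /unif1 /= /uniform_prob integral_uniform_pdf.
have -> : `[c, +oo[%classic `&` `[0, 1]%classic = `[c, 1]%classic :> set R.
  apply/seteqP; split => x; rewrite /= !in_itv/= ?andbT.
    by move=> [-> /andP[_ ->]].
  by move=> /andP[cx ->]; rewrite cx (le_trans c0 cx).
rewrite (eq_integral (fun=> 1%:E)); last first.
  move=> x; rewrite inE/= in_itv/= => /andP[cx x1].
  by rewrite /uniform_pdf (le_trans c0 cx) x1/= subr0 invr1.
rewrite integral_cst// mul1e; apply: etrans (lebesgue_measure_itv `[c, 1]) _.
rewrite /= lte_fin.
by case: ltgtP c1 => // -> _; rewrite subrr.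
Qed.

Let upper (j : nat) := [set x | (j <= cell x)%N].

Let upperE j : upper j =
  if j == 0%N then setT else if (j <= n)%N then `[j%:R / k%:R, +oo[%classic
  else set0.
Proof.
apply/seteqP; split => x; rewrite /upper /= cell_ge.
  by case: eqP => //= _; case: ifP => //= _; rewrite in_itv/= andbT.
by case: eqP => //= _; case: ifP => //= _; rewrite in_itv/= andbT.
Qed.

Let measurable_upper j : measurable (upper j).
Proof. by rewrite upperE; case: ifP => // _; case: ifP. Qed.

Let unif1_upper j : (j <= k)%N -> P (upper j) = (1 - j%:R / k%:R)%:E.
Proof.
move=> jk; rewrite upperE; case: eqP => [->|_].
  by rewrite mul0r subr0; exact: probability_setT.
case: ifPn => [jn|]; last first.
  rewrite -ltnNge => nj; have -> : j = k by apply/eqP; rewrite eqn_leq jk.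
  by rewrite measure0 divff ?gt_eqF// subrr.
rewrite unif1_itvcy// divr_ge0//= ler_pdivrMr// mul1r ler_nat//.
Qed.

Let cellE r : cell @^-1` [set r] = upper r `\` upper r.+1.
Proof.
apply/seteqP; split => x /=.
  by move=> <-; rewrite /upper /= leqnn ltnn.
by rewrite /upper /= => -[rx /negP]; rewrite -ltnNge ltnS => xr;
  apply/val_inj/eqP; rewrite eqn_leq xr rx.
Qed.

Lemma measurable_cell r : measurable (cell @^-1` [set r]).
Proof. by rewrite cellE; exact: measurableD. Qed.

Lemma unif1_cell r : P (cell @^-1` [set r]) = (k%:R^-1)%:E.
Proof.
rewrite cellE measureD//; [|exact: measurable_upper..|]; last first.
  apply: le_lt_trans (ltry 1).
  exact: (@probability_le1 _ _ _ P _ (measurable_upper _)).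
rewrite setIidr; last by move=> x; exact: ltnW.
transitivity ((1 - r%:R / k%:R : R)%:E - (1 - r.+1%:R / k%:R : R)%:E)%E.
  by congr (_ - _)%E; apply: unif1_upper => //; exact: ltnW.
by rewrite -EFinB; congr EFin; rewrite -natr1; field; rewrite gt_eqF.
Qed.

Lemma stepE (u : 'I_k -> R) x :
  u (cell x) = \sum_r u r * \1_(cell @^-1` [set r]) x.
Proof.
rewrite (bigD1 (cell x))//= indicE mem_set// mulr1 big1 ?addr0// => r rx.
by rewrite indicE memNset ?mulr0// => /= xr; rewrite xr eqxx in rx.
Qed.

Lemma bmeas_indic d (T : measurableType d) (A : set T) : measurable A ->
  bmeas (\1_A : T -> R).
Proof.
move=> mA; split; first exact: measurable_indic.
by exists 1 => x; rewrite indicE ger0_norm// lern1; case: (_ \in _).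
Qed.

Lemma bmeas_sum d (T : measurableType d) (J : Type) (r : seq J)
   (u : J -> T -> R) :
  (forall j, bmeas (u j)) -> bmeas (fun x => \sum_(j <- r) u j x).
Proof.
move=> bu; elim: r => [|j r IH].
  under eq_fun do rewrite big_nil.
  by split; [exact: measurable_cst|exists 0 => x; rewrite normr0].
under eq_fun do rewrite big_cons.
have [mu [M uM]] := bu j; have [ms [N sN]] := IH.
split; first exact: measurable_funD.
by exists (M + N) => x; exact: le_trans (ler_normD _ _) (lerD (uM x) (sN x)).
Qed.

Lemma bmeas_step (u : 'I_k -> R) :
  @bmeas _ (measurableTypeR R) R (fun x => u (cell x)).
Proof.
under eq_fun do rewrite stepE; apply: bmeas_sum => r.
exact: (adm_scale (averaging_Rintegral P) (u r)
  (bmeas_indic (measurable_cell r))).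
Qed.

Lemma Rintegral_step (u : 'I_k -> R) : \int[P]_x u (cell x) = mean u.
Proof.
under eq_Rintegral do rewrite stepE.
have bE r : @bmeas _ (measurableTypeR R) R
    (fun x => u r * \1_(cell @^-1` [set r]) x).
  exact: (adm_scale (averaging_Rintegral P) (u r)
    (bmeas_indic (measurable_cell r))).
suff H (s : seq 'I_k) :
    \int[P]_x (\sum_(r <- s) u r * \1_(cell @^-1` [set r]) x)
    = \sum_(r <- s) k%:R^-1 * u r by rewrite H /mean mulr_sumr.
elim: s => [|r s IH].
  by under eq_Rintegral do rewrite big_nil; rewrite Rintegral_cst// mul0r big_nil.
under eq_Rintegral do rewrite big_cons.
rewrite (avgD (averaging_Rintegral P) (bE r)); last exact: bmeas_sum.
rewrite IH big_cons; congr (_ + _).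
rewrite (avgZ (averaging_Rintegral P)); last first.
  exact: bmeas_indic (measurable_cell r).
rewrite /Rintegral integral_indic//; last exact: measurable_cell.
by rewrite setIT mulrC; congr (_ * _); have /(congr1 fine) := unif1_cell r.
Qed.

End Cells.

(** * Approximation of continuous functions by step functions *)

Section Approximation.
Variable R : realType.
Implicit Types (phi : R * R -> R).

Lemma compact_unit_square : compact (@unit_square R).
Proof. by apply: compact_setX; exact: segment_compact. Qed.

Lemma unit_square_uniform phi : {within @unit_square R, continuous phi} ->
  forall e : R, 0 < e -> exists2 d : R, 0 < d &
  forall z w, unit_square z -> unit_square w ->
    `|z.1 - w.1| < d -> `|z.2 - w.2| < d -> `|phi z - phi w| <= e.
Proof.
move=> cphi e e0.
have /compact_near_coveringP := compact_unit_square.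
move=> /(_ R (0 : R)^'+ (fun d z => forall w, unit_square z -> unit_square w ->
    `|z.1 - w.1| < d -> `|z.2 - w.2| < d -> `|phi z - phi w| <= e)).
case=> [z0 Kz0|d d0 dP]; last first.
- have d20 : 0 < d / 2 by rewrite divr_gt0.
  exists (d / 2) => // z w Kz Kw; apply: (dP (d / 2)) => //=.
  by rewrite sub0r normrN gtr0_norm// ltr_pdivrMr// ltr_pMr// ltr1n.
- move/subspace_continuousP : cphi => /(_ z0 Kz0)/cvgrPdist_lt /(_ (e / 2)).
  rewrite divr_gt0// => /(_ isT); rewrite near_withinE => /nbhs_ballP[r /= r0 rP].
  exists (ball z0 (r / 2), [set d | 0 < d < r / 2]) => /=.
    split; first by apply: nbhsx_ballx; rewrite divr_gt0.
    exists (r / 2) => [|x /=]; first by rewrite /= divr_gt0.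
    by rewrite sub0r normrN => + x0; rewrite gtr0_norm// x0.
  move=> [z d] /= [[b1 b2] /andP[d0 dr]] w Kz Kw zw1 zw2.
  have hz : `|phi z0 - phi z| < e / 2.
    by apply: rP => //; split=> /=; rewrite /ball/= in b1 b2 *; lra.
  have hw : `|phi z0 - phi w| < e / 2.
    apply: rP => //; split=> /=; rewrite /ball/= in b1 b2 *.
      by rewrite -(subrK z.1 z0.1) -addrA (le_lt_trans (ler_normD _ _))//; lra.
    by rewrite -(subrK z.2 z0.2) -addrA (le_lt_trans (ler_normD _ _))//; lra.
  rewrite -(subrK (phi z0) (phi z)) -addrA (le_trans (ler_normD _ _))//.
  by rewrite distrC; lra.
Qed.

Lemma unit_square_bounded phi : {within @unit_square R, continuous phi} ->
  exists M : R, forall z, unit_square z -> `|phi z| <= M.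
Proof.
move=> cphi.
have /compact_bounded[M [_ HM]] := continuous_compact cphi compact_unit_square.
exists (M + 1) => z Kz; apply: HM; first by rewrite ltrDl.
by exists z.
Qed.

Definition clamp (x : R) : R := Num.max 0 (Num.min x 1).

(** Only the values of phi on the square are controlled; projecting onto the
    square turns them into a bounded function on the plane. *)
Definition clamped phi (x y : R) : R := phi (clamp x, clamp y).

Lemma clamp_itv x : 0 <= clamp x <= 1.
Proof. by rewrite /clamp le_max lexx/= ge_max ler01/= ge_min lexx orbT. Qed.

Lemma clamp_square x y : unit_square (clamp x, clamp y).
Proof. by split; rewrite /= in_itv/= clamp_itv. Qed.

Lemma clamp_id x : 0 <= x <= 1 -> clamp x = x.
Proof. by move=> /andP[x0 x1]; rewrite /clamp min_l// max_r. Qed.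

Lemma clamped_square phi z : unit_square z -> clamped phi z.1 z.2 = phi z.
Proof.
case: z => x y [] /=; rewrite !in_itv/= => x01 y01.
by rewrite /clamped !clamp_id.
Qed.

Lemma grid_square n (r s : 'I_n.+1) : unit_square (grid R r s).
Proof.
have H (i : 'I_n.+1) : 0 <= (i.+1%:R / n.+1%:R : R) <= 1.
  apply/andP; split; first by rewrite divr_ge0.
  by rewrite ler_pdivrMr ?ltr0n// mul1r ler_nat.
by split; rewrite /= in_itv/= H.
Qed.

Lemma grid_cell_dist n (x : R) :
  `|(cell n x).+1%:R / n.+1%:R - clamp x| <= n.+1%:R^-1.
Proof.
have k0 : 0 < n.+1%:R :> R by rewrite ltr0n.
have lo : (cell n x)%:R / n.+1%:R <= clamp x.
  have := leqnn (cell n x); rewrite cell_ge => /orP[/eqP->|/andP[_ cx]].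
    by rewrite mul0r; have /andP[] := clamp_itv x.
  rewrite /clamp le_max le_min cx/=; apply/orP; right.
  by rewrite ler_pdivrMr// mul1r ler_nat ltnW.
have hi : clamp x <= (cell n x).+1%:R / n.+1%:R.
  rewrite /clamp ge_max ge_min; apply/andP; split; first by rewrite divr_ge0.
  have := ltnn (cell n x); rewrite cell_ge/= => /negbT; rewrite negb_and.
  case/orP; last by rewrite -ltNge => /ltW ->.
  rewrite -ltnNge => nc; apply/orP; right.
  by rewrite ler_pdivlMr// mul1r ler_nat.
have kE : n.+1%:R^-1 = (cell n x).+1%:R / n.+1%:R - (cell n x)%:R / n.+1%:R :> R.
  by rewrite -[(cell n x).+1%:R]natr1; field; rewrite gt_eqF.
by rewrite ger0_norm ?subr_ge0// [leRHS]kE lerD2l lerN2.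
Qed.

Definition gridstep phi n (x y : R) : R := phi (grid R (cell n x) (cell n y)).

Lemma gridstep_uniform phi : {within @unit_square R, continuous phi} ->
  forall e : R, 0 < e -> \forall n \near \oo, forall x y,
    `|gridstep phi n x y - clamped phi x y| <= e.
Proof.
move=> cphi e e0; have [d d0 dP] := unit_square_uniform cphi e0.
have : \forall n \near \oo, n.+1%:R^-1 < d.
  have /cvgr0Pnorm_lt /(_ d d0) := @cvg_harmonic R.
  by apply: filterS => n; rewrite /= ger0_norm.
apply: filterS => n nd x y; apply: dP; first exact: grid_square.
- exact: clamp_square.
- exact: le_lt_trans (grid_cell_dist n x) nd.
- exact: le_lt_trans (grid_cell_dist n y) nd.
Qed.

End Approximation.

(** * The continuous Schroedinger system as a limit of discrete ones *)

Section UniformConvergence.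
Variables (R : realType) (T : Type).
Implicit Types (u : nat -> T -> R) (v : T -> R).

Definition ucvg u v := forall e : R, 0 < e ->
  \forall n \near \oo, forall t, `|u n t - v t| <= e.

Lemma ucvg_pointwise u v t : ucvg u v -> u n t @[n --> \oo] --> v t.
Proof.
move=> uv; apply/cvgrPdist_le => e e0; apply: filterS (uv e e0) => n /(_ t).
by rewrite distrC.
Qed.

Lemma ucvgB u u' v v' : ucvg u v -> ucvg u' v' ->
  ucvg (fun n t => u n t - u' n t) (fun t => v t - v' t).
Proof.
move=> uv uv' e e0; have e20 : 0 < e / 2 by rewrite divr_gt0.
apply: filterS2 (uv _ e20) (uv' _ e20) => n h h' t.
have -> : u n t - u' n t - (v t - v' t) = (u n t - v t) - (u' n t - v' t) by ring.
by rewrite (le_trans (ler_normB _ _))//; have := h t; have := h' t; lra.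
Qed.

Lemma ucvgZ (c : R) u v : ucvg u v ->
  ucvg (fun n t => c * u n t) (fun t => c * v t).
Proof.
move=> uv e e0; have c0 : 0 < `|c| + 1 by rewrite ltr_wpDl.
have ec0 : 0 < e / (`|c| + 1) by rewrite divr_gt0.
apply: filterS (uv _ ec0) => n h t; rewrite -mulrBr normrM.
have := h t; rewrite ler_pdivlMr// => ht; apply: le_trans ht.
by rewrite mulrC ler_wpM2l// lerDl.
Qed.

Lemma ucvgM u u' v v' (M M' : R) : (forall t, `|v t| <= M) ->
  (forall t, `|v' t| <= M') -> ucvg u v -> ucvg u' v' ->
  ucvg (fun n t => u n t * u' n t) (fun t => v t * v' t).
Proof.
move=> vM vM' uv uv' e e0.
pose C := `|M| + `|M'| + 1.
have C0 : 0 < C by rewrite /C ltr_wpDl// addr_ge0.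
pose d := Num.min 1 (e / (2 * C)).
have d0 : 0 < d by rewrite lt_min ltr01 divr_gt0// mulr_gt0.
apply: filterS2 (uv _ d0) (uv' _ d0) => n h h' t.
have -> : u n t * u' n t - v t * v' t =
  (u n t - v t) * (u' n t - v' t) + (v t * (u' n t - v' t)
    + (u n t - v t) * v' t) by ring.
have h1 : `|(u n t - v t) * (u' n t - v' t)| <= d * 1.
  by rewrite normrM ler_pM// (le_trans (h' t))// ge_min lexx.
have h2 : `|v t * (u' n t - v' t)| <= `|M| * d.
  by rewrite normrM ler_pM// (le_trans (vM t))// ler_norm.
have h3 : `|(u n t - v t) * v' t| <= d * `|M'|.
  by rewrite normrM ler_pM// (le_trans (vM' t))// ler_norm.
apply: (@le_trans _ _ (d * C)).
  rewrite (le_trans (ler_normD _ _))//.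
  have := ler_normD (v t * (u' n t - v' t)) ((u n t - v t) * v' t).
  by rewrite /C; lra.
apply: (@le_trans _ _ (e / (2 * C) * C)).
  by rewrite ler_pM2r// ge_min lexx orbT.
by rewrite invfM mulrA mulfVK ?gt_eqF//; lra.
Qed.

Lemma ucvg_expR u v (M : R) : (forall t, v t <= M) -> ucvg u v ->
  ucvg (fun n t => expR (u n t)) (fun t => expR (v t)).
Proof.
move=> vM uv e e0; pose K := expR (M + 1).
have K0 : 0 < K by exact: expR_gt0.
pose d := Num.min 1 (e / K).
have d0 : 0 < d by rewrite lt_min ltr01 divr_gt0.
have lip (a b : R) : a <= M + 1 -> `|a - b| <= d -> expR a - expR b <= e.
  move=> aM abd; have abe : `|a - b| * K <= e.
    by rewrite -ler_pdivlMr// (le_trans abd)// ge_min lexx orbT.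
  apply: le_trans abe.
  have -> : expR b = expR a * expR (b - a) by rewrite -expRD; congr expR; ring.
  have : 1 - expR (b - a) <= `|a - b|.
    by have := expR_ge1Dx (b - a); have := ler_norm (a - b); lra.
  have Ka : expR a <= K by rewrite ler_expR.
  move=> H; have : expR a * (1 - expR (b - a)) <= expR a * `|a - b|.
    by rewrite ler_pM2l ?expR_gt0.
  have : expR a * `|a - b| <= K * `|a - b| by rewrite ler_wpM2r.
  lra.
apply: filterS (uv _ d0) => n h t; have ht := h t.
have d1 : d <= 1 by rewrite ge_min lexx.
have uM : u n t <= M + 1.
  by have := ler_norm (u n t - v t); have := vM t; lra.
rewrite ler_norml lerNl opprB; apply/andP; split; apply: lip => //.
  by have := vM t; lra.
by rewrite distrC.
Qed.

Lemma ucvg_cauchy u :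
  (forall e : R, 0 < e -> exists N, forall n m, (N <= n)%N -> (N <= m)%N ->
     forall t, `|u n t - u m t| <= e) -> exists v, ucvg u v.
Proof.
move=> cu; have cv t : cvgn (u ^~ t).
  apply/cauchy_cvgP/cauchy_exP => e e0.
  have e20 : 0 < e / 2 by rewrite divr_gt0.
  have [N NP] := cu _ e20; exists (u N t); exists N => //= n Nn.
  by rewrite /ball/= (le_lt_trans (NP N n _ _ t))// ltr_pdivrMr// ltr_pMr// ltr1n.
exists (fun t => limn (u ^~ t)) => e e0; have [N NP] := cu e e0.
exists N => //= n Nn t.
have c : `|u n t - u m t| @[m --> \oo] --> `|u n t - limn (u ^~ t)|.
  by apply: cvg_norm; apply: cvgB; [exact: cvg_cst|exact: cv].
rewrite -(cvg_lim _ c)//; apply: limr_le; first by apply/cvg_ex; eexists; exact: c.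
by exists N => //= m Nm; exact: NP.
Qed.

Lemma ucvg_avg adm I (HI : @averaging R T adm I) u v :
  (forall n, adm (u n)) -> adm v -> ucvg u v -> I (u n) @[n --> \oo] --> I v.
Proof.
move=> au av uv; apply/cvgrPdist_le => e e0.
apply: filterS (uv e e0) => n h; rewrite distrC.
exact: (avg_dist HI (au n) av h).
Qed.

End UniformConvergence.

Section Square.
Variable R : realType.
Local Notation R1 := (measurableTypeR R).
Local Notation R2 := (measurableTypeR R * measurableTypeR R)%type.
Local Notation P := (unif1 R).
Local Notation I1 := (fun u : R1 -> R => \int[P]_x u x).

Lemma bmeas_comp d d' (T : measurableType d) (T' : measurableType d')
    (g : T -> T') (u : T' -> R) : measurable_fun setT g ->
  bmeas u -> bmeas (u \o g).
Proof.
move=> mg [mu [M uM]]; split; first exact: measurableT_comp.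
by exists M => x; exact: uM.
Qed.

Lemma bmeas_xsection (u : R2 -> R) x : bmeas u -> @bmeas _ R1 R (fun y => u (x, y)).
Proof.
by apply: (bmeas_comp (g := fun y : R1 => (x, y) : R2)); exact: measurable_pair1.
Qed.

Lemma bmeas_ysection (u : R2 -> R) y : bmeas u -> @bmeas _ R1 R (fun x => u (x, y)).
Proof.
by apply: (bmeas_comp (g := fun x : R1 => (x, y) : R2)); exact: measurable_pair2.
Qed.

Lemma Rintegral_unif2 (u : R2 -> R) : bmeas u ->
  \int[unif2 R]_z u z = I1 (fun x => I1 (fun y => u (x, y))).
Proof.
move=> bu; rewrite /Rintegral.
have iu : ((unif1 R) \x (unif1 R))%E.-integrable setT (EFin \o u).
  exact: (bmeas_integrable (unif2 R) bu).
rewrite -(integral12_prod_meas1 iu); congr fine; apply: eq_integral => x _.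
rewrite /fubini_F fineK//.
apply: integrable_fin_num => //; apply: (bmeas_integrable P).
exact: bmeas_xsection.
Qed.

Lemma Rintegral_unif2_swap (u : R2 -> R) : bmeas u ->
  \int[unif2 R]_z u z = I1 (fun y => I1 (fun x => u (x, y))).
Proof.
move=> bu; rewrite /Rintegral.
have iu : ((unif1 R) \x (unif1 R))%E.-integrable setT (EFin \o u).
  exact: (bmeas_integrable (unif2 R) bu).
rewrite -(integral21_prod_meas1 iu); congr fine; apply: eq_integral => y _.
rewrite /fubini_G fineK//.
apply: integrable_fin_num => //; apply: (bmeas_integrable P).
exact: bmeas_ysection.
Qed.

Lemma bmeas_step2 n (u : 'I_n.+1 -> 'I_n.+1 -> R) :
  @bmeas _ R2 R (fun z => u (cell n z.1) (cell n z.2)).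
Proof.
under eq_fun do rewrite (stepE (fun r => u r _)).
apply: bmeas_sum => r.
apply: (adm_mul (averaging_Rintegral (unif2 R))).
  exact: (bmeas_comp (g := snd : R2 -> R1) (u := fun y => u r (cell n y))
    measurable_snd (bmeas_step (u r))).
exact: (bmeas_comp (g := fst : R2 -> R1) measurable_fst
  (bmeas_indic R (measurable_cell r))).
Qed.

Lemma Rintegral_step2 n (u : 'I_n.+1 -> 'I_n.+1 -> R) :
  \int[unif2 R]_z u (cell n z.1) (cell n z.2) = mean (fun r => mean (u r)).
Proof.
rewrite (Rintegral_unif2 (bmeas_step2 u))/= -Rintegral_step.
by apply: eq_Rintegral => x _; rewrite -Rintegral_step.
Qed.

End Square.

Section Limit.
Variables (R : realType) (f : R * R -> R) (theta : R).
Local Notation R1 := (measurableTypeR R).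
Local Notation R2 := (measurableTypeR R * measurableTypeR R)%type.
Local Notation P := (unif1 R).
Local Notation I1 := (fun u : R1 -> R => \int[P]_x u x).
Hypothesis cf : {within @unit_square R, continuous f}.
Variables (A : forall n, 'M[R]_n.+1) (l : forall n, 'I_n.+1 -> 'I_n.+1 -> R).
Hypothesis oA : forall n, optimal f theta (A n) (@l n).

Let ell n (z : R2) : R := @l n (cell n z.1) (cell n z.2).
Let HP := averaging_Rintegral P.
Let HP2 := averaging_Rintegral (unif2 R).

Lemma bmeas_gridstep phi n :
  @bmeas _ R2 R (fun z => gridstep phi n z.1 z.2).
Proof. exact: (bmeas_step2 (fun r s => phi (grid R r s))). Qed.

Lemma gridstep_ucvg phi : {within @unit_square R, continuous phi} ->
  ucvg (fun n (z : R2) => gridstep phi n z.1 z.2)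
    (fun z => clamped phi z.1 z.2).
Proof.
move=> cphi e e0; apply: filterS (gridstep_uniform cphi e0) => n h z.
exact: h.
Qed.

Lemma bmeas_clamped phi : {within @unit_square R, continuous phi} ->
  @bmeas _ R2 R (fun z => clamped phi z.1 z.2).
Proof.
move=> cphi; apply: (bmeas_lim (bmeas_gridstep phi)); exact: gridstep_ucvg.
Qed.

Let schrodinger_step n :
  schrodinger (@bmeas _ R1 R) I1 (fun x y => theta * gridstep f n x y)
    (fun x y => ell n (x, y)).
Proof.
have [_ [row col [a [b [_ _ lE]]]] _] := oA n; split=> [x|y|].
- by rewrite (Rintegral_step (fun s => expR (@l n (cell n x) s))) row.
- by rewrite (Rintegral_step (fun r => expR (l r (cell n y)))) col.
- exists (fun x => a (cell n x)), (fun y => b (cell n y)); split.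
  + exact: bmeas_step.
  + exact: bmeas_step.
  + by move=> x y; rewrite /ell/= lE.
Qed.

(** As step functions, the solutions for different numbers of cells live on the
    same space, so that they can be compared by stability. *)
Lemma ell_cauchy : forall e : R, 0 < e -> exists N, forall n m,
  (N <= n)%N -> (N <= m)%N -> forall z, `|ell n z - ell m z| <= e.
Proof.
move=> e e0; have [M0 fM] := unit_square_bounded cf.
pose M := `|theta| * M0; pose K := 2 * expR (4 * M) + 2.
have K0 : 0 < K by rewrite /K; have := expR_gt0 (4 * M); lra.
pose d := e / (2 * K * (`|theta| + 1)).
have t0 : 0 < `|theta| + 1 by rewrite ltr_wpDl.
have d0 : 0 < d by rewrite divr_gt0// !mulr_gt0.
have [N /= _ NP] := gridstep_uniform cf d0.
exists N => n m Nn Nm [x y].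
apply: (@le_trans _ _ (K * (`|theta| * (2 * d)))); last first.
  have -> : e = K * ((`|theta| + 1) * (2 * d)).
    by rewrite /d; field; rewrite !gt_eqF//.
  by rewrite ler_pM2l// ler_wpM2r ?lerDl// mulr_ge0// ltW.
apply: (schrodinger_stable HP (F := fun x y => theta * gridstep f n x y)
  (F' := fun x y => theta * gridstep f m x y) (M := M) _ _ _ _ _ _
  (schrodinger_step n) (schrodinger_step m)).
- by move=> x' y'; rewrite normrM ler_wpM2l// fM//; exact: grid_square.
- move=> x'; apply: (adm_scale HP).
  exact: (bmeas_xsection x' (bmeas_gridstep f n)).
- move=> y'; apply: (adm_scale HP theta (u := fun x => gridstep f n x y')).
  exact: (bmeas_ysection y' (bmeas_gridstep f n)).
- move=> x'; apply: (adm_scale HP).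
  exact: (bmeas_xsection x' (bmeas_gridstep f m)).
- move=> y'; apply: (adm_scale HP theta (u := fun x => gridstep f m x y')).
  exact: (bmeas_ysection y' (bmeas_gridstep f m)).
- move=> x' y'; rewrite -mulrBr normrM ler_wpM2l//.
  have h1 := NP n Nn x' y'; have h2 := NP m Nm x' y'.
  rewrite -(subrK (clamped f x' y') (gridstep f n x' y')) -addrA.
  by rewrite (le_trans (ler_normD _ _))// mulr2n mulrDl mul1r lerD// distrC.
Qed.

(** The discrete log-densities, as step functions on the square, converge
    uniformly, by stability; the limit solves the continuous system. *)
Lemma schrodinger_limit : exists L : R2 -> R, [/\ bmeas L,
  ucvg ell L &
  schrodinger (@bmeas _ R1 R) I1 (fun x y => theta * clamped f x y)
    (fun x y => L (x, y))].
Proof.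
have [L cL] := ucvg_cauchy ell_cauchy.
have bell n : bmeas (ell n) by exact: bmeas_step2.
have bL : bmeas L by exact: bmeas_lim bell cL.
exists L; split => //.
have [_ [M LM]] := bL.
have LM' z : L z <= M by exact: le_trans (ler_norm _) (LM z).
have rowcvg (g : R1 -> R2) : measurable_fun setT g ->
    (forall n, I1 (fun t => expR (ell n (g t))) = 1) ->
    I1 (fun t => expR (L (g t))) = 1.
  move=> mg H.
  have /(ucvg_avg HP) : ucvg (fun n t => expR (ell n (g t))) (fun t => expR (L (g t))).
    apply: (@ucvg_expR _ _ _ _ M) => // e e0.
    by apply: filterS (cL e e0) => n h t; exact: h.
  have bLg : bmeas (fun t => expR (L (g t))).
    by apply: (adm_exp HP); exact: (bmeas_comp mg bL).
  move=> /(_ _ bLg) h.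
  have {}h := h (fun n => adm_exp HP (bmeas_comp mg (bell n))).
  have : (fun=> 1) @ \oo --> I1 (fun t => expR (L (g t))).
    by move: h; under eq_fun do rewrite H.
  by move/(cvg_unique (@Rhausdorff R)) => /(_ _ (cvg_cst _)) ->.
split=> [x|y|].
- apply: (rowcvg (fun y => (x, y))); first exact: measurable_pair1.
  by move=> n; have [H _ _] := schrodinger_step n; exact: H.
- apply: (rowcvg (fun x => (x, y))); first exact: measurable_pair2.
  by move=> n; have [_ H _] := schrodinger_step n; exact: H.
pose F (z : R2) := theta * clamped f z.1 z.2.
have bF : bmeas F by apply: (adm_scale HP2); exact: bmeas_clamped.
have bLF : bmeas (fun z => L z - F z).
  by apply: (adm_add HP2) => //; exact: adm_opp HP2 _ bF.
have cLF z : ell n z - theta * gridstep f n z.1 z.2 @[n --> \oo] --> L z - F z.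
  exact: (ucvg_pointwise (ucvgB cL (ucvgZ theta (gridstep_ucvg cf)))).
exists (fun x => L (x, 0) - F (x, 0)).
exists (fun y => (L (0, y) - F (0, y)) - (L (0, 0) - F (0, 0))); split.
- exact: (bmeas_ysection 0 bLF).
- apply: (adm_add HP); first exact: (bmeas_xsection 0 bLF).
  exact: (adm_cst HP).
- move=> x y.
  have : L (x, y) - F (x, y) = L (x, 0) - F (x, 0) +
      (L (0, y) - F (0, y)) - (L (0, 0) - F (0, 0)).
    have H : ell n (x, y) - theta * gridstep f n x y @[n --> \oo] -->
        L (x, 0) - F (x, 0) + (L (0, y) - F (0, y)) - (L (0, 0) - F (0, 0)).
      have E n : ell n (x, y) - theta * gridstep f n x y =
         (ell n (x, 0) - theta * gridstep f n x 0)
         + (ell n (0, y) - theta * gridstep f n 0 y)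
         - (ell n (0, 0) - theta * gridstep f n 0 0).
        by have [_ _ [a [b [_ _ lE]]]] := schrodinger_step n; rewrite !lE; ring.
      under eq_fun do rewrite E.
      by apply: cvgB (cLF (0, 0)); exact: cvgD (cLF (x, 0)) (cLF (0, y)).
    exact: (cvg_unique (@Rhausdorff R) (cLF (x, y)) H).
  by rewrite {1}/F/=; lra.
Qed.

Section Consequences.
Variable L : R2 -> R.
Hypothesis bL : bmeas L.
Hypothesis cL : ucvg ell L.

Lemma W_limit : W n.+1 f theta @[n --> \oo] -->
  - \int[unif2 R]_z (L z - theta * clamped f z.1 z.2).
Proof.
have E n : W n.+1 f theta =
    - \int[unif2 R]_z (ell n z - theta * gridstep f n z.1 z.2).
  rewrite (W_mean (oA n)).
  by rewrite -(Rintegral_step2 (fun r s => @l n r s - gridf f theta r s)).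
under eq_fun do rewrite E.
apply: cvgN; apply: (ucvg_avg HP2).
- move=> n; apply: (adm_add HP2); first exact: bmeas_step2.
  by apply: (adm_opp HP2); apply: (adm_scale HP2); exact: bmeas_gridstep.
- apply: (adm_add HP2) => //.
  by apply: (adm_opp HP2); apply: (adm_scale HP2); exact: bmeas_clamped.
- by apply: ucvgB => //; apply: ucvgZ; exact: gridstep_ucvg.
Qed.

Lemma obs_limit phi : {within @unit_square R, continuous phi} ->
  obs phi (A n) @[n --> \oo] -->
  \int[unif2 R]_z (clamped phi z.1 z.2 * expR (L z)).
Proof.
move=> cphi.
have E n : obs phi (A n) =
    \int[unif2 R]_z (gridstep phi n z.1 z.2 * expR (ell n z)).
  rewrite (Rintegral_step2 (fun r s => phi (grid R r s) * expR (@l n r s))).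
  have [_ _ AE] := oA n; rewrite /obs /mean mulr_sumr; apply: eq_bigr => r _.
  rewrite mulrA mulr_sumr; apply: eq_bigr => s _; rewrite AE expr2 invfM.
  by ring.
under eq_fun do rewrite E.
have [_ [M LM]] := bL; have [_ [N fN]] := bmeas_clamped cphi.
apply: (ucvg_avg HP2).
- move=> n; apply: (adm_mul HP2); first exact: bmeas_gridstep.
  by apply: (adm_exp HP2); exact: bmeas_step2.
- by apply: (adm_mul HP2); [exact: bmeas_clamped|exact: (adm_exp HP2)].
- apply: (ucvgM (M := N) (M' := expR M)) => //.
  + move=> z; rewrite ger0_norm ?expR_ge0// ler_expR.
    exact: le_trans (ler_norm _) (LM z).
  + exact: gridstep_ucvg.
  + apply: (ucvg_expR (M := M)) => // z; exact: le_trans (ler_norm _) (LM z).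
Qed.

End Consequences.

End Limit.

(** * The Gibbs inequality *)

Section Gibbs.
Variables (d : measure_display) (T : measurableType d) (R : realType).
Variables (mu nu : probability T R).
Local Open Scope ereal_scope.

Lemma le_integral_measurable (f g : T -> \bar R) :
  measurable_fun setT f -> measurable_fun setT g -> (forall x, f x <= g x) ->
  \int[mu]_x f x <= \int[mu]_x g x.
Proof.
move=> mf mg fg; rewrite integralE [leRHS]integralE leeB//.
- apply: ge0_le_integral => //; [exact: measurable_funepos..|].
  move=> x _; apply: (@funepos_le _ _ setT); last exact: in_setT.
  by move=> y _; exact: fg.
- apply: ge0_le_integral => //; [exact: measurable_funeneg..|].
  move=> x _; apply: (@funeneg_le _ _ setT); last exact: in_setT.
  by move=> y _; exact: fg.
Qed.

Variable L : T -> R.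
Hypothesis bL : bmeas L.

Let bexpL : bmeas (fun x => expR (L x)).
Proof. exact: adm_exp (averaging_Rintegral nu) _ bL. Qed.

Let mexpL : measurable_fun setT (EFin \o (fun x => expR (L x))).
Proof. by apply/measurable_EFinP; case: bexpL. Qed.

Let mLE : measurable_fun setT (EFin \o L).
Proof. by apply/measurable_EFinP; case: bL. Qed.

Section AbsolutelyContinuous.
Hypothesis munu : mu `<< nu.
Hypothesis expL1 : \int[nu]_x (expR (L x))%:E = 1.

Let H := Radon_Nikodym_SigmaFinite.f mu nu.
Let h x := fine (H x).

Let HE x : H x = (h x)%:E.
Proof. by rewrite /h fineK//; exact: Radon_Nikodym_SigmaFinite.f_fin_num. Qed.

Let mH : measurable_fun setT H.
Proof. exact: measurable_int (Radon_Nikodym_SigmaFinite.f_integrable munu). Qed.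

Let mlnh : measurable_fun setT (fun x => ln (h x)).
Proof. by apply: measurableT_comp => //; exact: measurableT_comp. Qed.

Let h0 x : (0 <= h x)%R.
Proof. by rewrite fine_ge0//; exact: Radon_Nikodym_SigmaFinite.f_ge0. Qed.

(** Where h is positive, this is the density of exp L . nu with respect to mu;
    the value of ln at 0 does not matter, as mu does not charge the set where
    its density h vanishes. *)
Let G x := expR (L x - ln (h x)).

Let mG : measurable_fun setT (EFin \o G).
Proof.
apply/measurable_EFinP; apply: measurableT_comp => //.
by apply: measurable_funB => //; case: bL.
Qed.

Let int_G_le A : measurable A ->
  \int[mu]_(x in A) (G x)%:E <= \int[nu]_(x in A) (expR (L x))%:E.
Proof.
move=> mA.
have G0 x : 0 <= (EFin \o G) x by rewrite lee_fin expR_ge0.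
have mGA : measurable_fun A (EFin \o G) by exact: measurable_funTS.
rewrite -(Radon_Nikodym_SigmaFinite.change_of_variables munu G0 mA mGA).
apply: ge0_le_integral => //.
- move=> x _; apply: mule_ge0; first by rewrite lee_fin expR_ge0.
  exact: Radon_Nikodym_SigmaFinite.f_ge0.
- by apply: measurable_funTS; apply: emeasurable_funM.
- exact: measurable_funTS.
- move=> x _; rewrite -/(H x) HE -EFinM lee_fin /G.
  have := h0 x; rewrite le_eqVlt => /predU1P[<-|hx]; first by rewrite mulr0 expR_ge0.
  by rewrite expRB lnK// mulfVK// gt_eqF.
Qed.

Let int_G_le1 : \int[mu]_x (G x)%:E <= 1.
Proof. by rewrite -expL1; exact: int_G_le. Qed.

Let integrable_G : mu.-integrable setT (EFin \o G).
Proof.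
apply/integrableP; split => //.
under eq_integral do rewrite /= ger0_norm ?expR_ge0//.
exact: le_lt_trans int_G_le1 (ltry _).
Qed.

Let KLE : KL mu nu = \int[mu]_x (ln (h x))%:E.
Proof.
rewrite /KL asboolT//; apply: ae_eq_integral => //.
- apply/measurable_EFinP; apply: measurableT_comp => //.
  by apply: measurableT_comp => //; apply: (measurable_int nu);
    exact: Radon_Nikodym_integrable.
- exact/measurable_EFinP.
- apply: (null_dominates_ae_eq _ munu) => //.
  have := ae_eq_Radon_Nikodym_SigmaFinite munu measurableT.
  by apply: filterS => x /(_ Logic.I) E _; rewrite /= /h /H E.
Qed.

Let psi x := (L x + 1 - G x)%R.

Let integrable_psi : mu.-integrable setT (EFin \o psi).
Proof.
have -> : EFin \o psi = (fun x => (L x + 1)%:E) \- (EFin \o G).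
  by apply/funext => x; rewrite /= -EFinB.
apply: integrableB => //; apply: bmeas_integrable.
have HP := averaging_Rintegral mu.
exact: (adm_add HP bL (adm_cst HP 1%R)).
Qed.

Let int_psi : \int[mu]_x (psi x)%:E =
  \int[mu]_x (L x)%:E + (1 - \int[mu]_x (G x)%:E).
Proof.
have iL := bmeas_integrable mu bL.
have i1 : mu.-integrable setT (cst 1 : T -> \bar R).
  have HP := averaging_Rintegral mu.
  exact: (bmeas_integrable mu (adm_cst HP 1%R)).
transitivity (\int[mu]_x ((L x)%:E + (1 - (G x)%:E))).
  by apply: eq_integral => x _; rewrite -EFinB -EFinD /psi; congr EFin; ring.
rewrite integralD//; last by apply: integrableB.
rewrite integralB//; congr (_ + (_ - _)).
by rewrite integral_cst// mul1e; exact: probability_setT.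
Qed.

Let fin_G : \int[mu]_x (G x)%:E \is a fin_num.
Proof. exact: integrable_fin_num. Qed.

Let fin_L : \int[mu]_x (L x)%:E \is a fin_num.
Proof. by apply: integrable_fin_num => //; exact: bmeas_integrable. Qed.

Let psi_le x : (psi x <= ln (h x))%R.
Proof. by rewrite /psi /G; have := expR_ge1Dx (L x - ln (h x))%R; lra. Qed.

Let mpsi : measurable_fun setT (EFin \o psi).
Proof. exact: measurable_int integrable_psi. Qed.

(** Integrate ln h >= psi = L + 1 - G against mu; the mass of G is at most 1. The
    integral of ln h is allowed to be infinite. *)
Lemma gibbs_KL_ge : \int[mu]_x (L x)%:E <= KL mu nu.
Proof.
rewrite KLE; apply: (@le_trans _ _ (\int[mu]_x (psi x)%:E)).
  by rewrite int_psi leeDl// sube_ge0 ?int_G_le1 ?fin_G ?orbT.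
apply: le_integral_measurable => //; exact/measurable_EFinP.
Qed.

(** In the case of equality, exp t - 1 - t vanishes almost everywhere at
    t = L - ln h, so that G is 1 almost everywhere. *)
Lemma gibbs_KL_eq : KL mu nu <= \int[mu]_x (L x)%:E ->
  forall A, measurable A -> mu A = \int[nu]_(x in A) (expR (L x))%:E.
Proof.
move=> KL_le.
have KL_fin : \int[mu]_x (ln (h x))%:E \is a fin_num.
  rewrite -KLE fin_numE; apply/andP; split.
    by rewrite gt_eqF// (lt_le_trans _ gibbs_KL_ge)// ltNye_eq fin_L.
  by rewrite lt_eqF// (le_lt_trans KL_le)// ltey_eq fin_L.
have ilnh : mu.-integrable setT (EFin \o (fun x => ln (h x))).
  apply/integrableP; split; first exact/measurable_EFinP.
  apply/abse_integralP => //; first exact/measurable_EFinP.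
  by rewrite ltey_eq abse_fin_num KL_fin.
pose D x := (ln (h x) - psi x)%R.
have D0 x : (0 <= D x)%R by rewrite subr_ge0.
have mD : measurable_fun setT (EFin \o D).
  apply/measurable_EFinP; apply: measurable_funB => //.
  exact/measurable_EFinP.
have intD : \int[mu]_x (D x)%:E = 0.
  apply/eqP; rewrite eq_le integral_ge0 ?andbT => [|x _]; last by rewrite lee_fin.
  under eq_integral do rewrite EFinB.
  rewrite integralB// int_psi -KLE sube_le0 (le_trans KL_le)// leeDl//.
  by rewrite sube_ge0 ?int_G_le1 ?fin_G ?orbT.
have G1 : ae_eq mu setT (EFin \o G) (cst 1).
  have : ae_eq mu setT (EFin \o D) (cst 0).
    apply/ae_eq_integral_abs => //; rewrite -[RHS]intD; apply: eq_integral => x _.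
    by rewrite /= ger0_norm.
  apply: filterS => x /(_ Logic.I)/= [Dx] _; rewrite /G /=; congr EFin.
  have [->|t0] := eqVneq (L x - ln (h x))%R 0%R; first by rewrite expR0.
  by have := expR_gt1Dx t0; move: Dx; rewrite /D /psi /G; lra.
(* A measure below a probability measure, with the same total mass, is equal to
   it. *)
have le_mass A : measurable A -> mu A <= \int[nu]_(x in A) (expR (L x))%:E.
  move=> mA; apply: le_trans (int_G_le mA).
  rewrite (@ae_eq_integral _ _ _ mu A (cst 1) (EFin \o G))//.
  - by rewrite integral_cst// mul1e.
  - exact: measurable_funTS.
  - by apply: filterS G1 => x /(_ Logic.I) E _.
move=> A mA; apply/eqP; rewrite eq_le le_mass//=.
have mAC : measurable (~` A) by exact: measurableC.
have sum1 : \int[nu]_(x in A) (expR (L x))%:E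
    + \int[nu]_(x in ~` A) (expR (L x))%:E = 1.
  rewrite -expL1 -(setvU A) ge0_integral_setU//.
  - by rewrite addeC.
  - by rewrite setvU.
  - by apply/disj_setPS => x [nAx Ax]; exact: nAx.
have := le_mass _ mAC; rewrite (@probability_setC _ _ _ mu)//.
have := fin_num_measure mu A mA.
move: sum1; set a := \int[nu]_(x in A) _; set b := \int[nu]_(x in ~` A) _.
set m := mu A; case: m => [m| |]//; case: b => [b| |]; case: a => [a| |]//.
  by rewrite -EFinD -EFinB !lee_fin => -[ab] _; lra.
by rewrite leey.
Qed.

End AbsolutelyContinuous.

Section Density.
Hypothesis density : forall A, measurable A ->
  mu A = \int[nu]_(x in A) (expR (L x))%:E.

Lemma density_dominates : mu `<< nu.
Proof.
apply/null_content_dominatesP => A mA nuA; rewrite density//.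
by apply: null_set_integral => //; exact: measurable_funTS.
Qed.

Lemma density_Radon_Nikodym : ae_eq nu setT
  (Radon_Nikodym (charge_of_finite_measure mu) nu)
  (EFin \o (fun x => expR (L x))).
Proof.
have munu := density_dominates.
apply: integral_ae_eq => //.
- exact: Radon_Nikodym_integrable.
- by move=> A _ mA; rewrite -Radon_Nikodym_integral// -density.
Qed.

Lemma density_KL : KL mu nu = \int[mu]_x (L x)%:E.
Proof.
have munu := density_dominates.
rewrite /KL asboolT//; apply: ae_eq_integral => //.
- apply/measurable_EFinP; apply: measurableT_comp => //.
  by apply: measurableT_comp => //; apply: (measurable_int nu);
    exact: Radon_Nikodym_integrable.
- apply: (null_dominates_ae_eq _ munu) => //.
  apply: filterS density_Radon_Nikodym => x /(_ Logic.I) /= -> _.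
  by rewrite /= expRK.
Qed.

End Density.

End Gibbs.

(** * Couplings of uniform measures *)

Lemma density_probability d (T : measurableType d) (R : realType)
    (nu : probability T R) (g : T -> R) :
  measurable_fun setT g -> (forall x, 0 <= g x) ->
  (\int[nu]_x (g x)%:E = 1)%E ->
  exists mu : probability T R,
    forall A, measurable A -> (mu A = \int[nu]_(x in A) (g x)%:E)%E.
Proof.
move=> mg g0 g1; pose m (A : set T) := (\int[nu]_(x in A) (g x)%:E)%E.
have m0 : m set0 = 0%E by rewrite /m integral_set0.
have m_ge0 A : (0 <= m A)%E.
  by apply: integral_ge0 => x _; rewrite lee_fin.
have m_sigma : semi_sigma_additive m.
  move=> F mF tF mUF; rewrite /m; apply: cvg_toP.
    apply: ereal_nondecreasing_is_cvgn => i j ij.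
    by apply: lee_sum_nneg_natr => // n _ _; exact: m_ge0.
  rewrite ge0_integral_bigcup//=.
  - by apply/measurable_funTS/measurable_EFinP.
  - by move=> x _; rewrite lee_fin.
pose M : {measure set T -> \bar R} :=
  HB.pack m (isMeasure.Build _ _ _ m m0 m_ge0 m_sigma).
have M1 : M setT = 1%E by exact: g1.
pose mu : probability T R :=
  HB.pack (Measure.sort M) (Measure_isProbability.Build _ _ _ (Measure.sort M) M1).
by exists mu.
Qed.

Section Couplings.
Variable R : realType.
Local Notation R1 := (measurableTypeR R).
Local Notation R2 := (measurableTypeR R * measurableTypeR R)%type.
Local Notation P := (unif1 R).
Implicit Types mu : probability R2 R.

Lemma Rintegral_pushforward d d' (T : measurableType d)
    (T' : measurableType d') (mu : probability T R) (nu : probability T' R)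
    (p : T -> T') (u : T' -> R) : measurable_fun setT p -> bmeas u ->
  (forall A, measurable A -> pushforward mu p A = nu A) ->
  \int[mu]_z u (p z) = \int[nu]_x u x.
Proof.
move=> mp bu pE; rewrite /Rintegral; congr fine.
have iu : mu.-integrable (p @^-1` setT) ((EFin \o u) \o p).
  rewrite preimage_setT; exact: (bmeas_integrable mu (bmeas_comp mp bu)).
have mu' : measurable_fun setT (EFin \o u) by apply/measurable_EFinP; case: bu.
have := integral_pushforward mp mu' iu measurableT.
rewrite preimage_setT => <-; apply: eq_measure_integral => A mA _.
exact: pE.
Qed.

Lemma coupling_fst mu (u : R1 -> R) : couplings mu -> bmeas u ->
  \int[mu]_z u z.1 = \int[P]_x u x.
Proof.
move=> cmu bu; apply: (Rintegral_pushforward (p := fst : R2 -> R1)) => //.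
by move=> A mA; have [-> _] := cmu A mA.
Qed.

Lemma coupling_snd mu (u : R1 -> R) : couplings mu -> bmeas u ->
  \int[mu]_z u z.2 = \int[P]_x u x.
Proof.
move=> cmu bu; apply: (Rintegral_pushforward (p := snd : R2 -> R1)) => //.
by move=> A mA; have [_ ->] := cmu A mA.
Qed.

Lemma coupling_unif2 : couplings (unif2 R).
Proof.
move=> A mA; rewrite /pushforward; split.
- have -> : fst @^-1` A = A `*` setT :> set R2.
    by apply/seteqP; split => [x Ax//|x []].
  apply: etrans (product_measure1E _ _ mA measurableT) _.
  by rewrite [X in (_ * X)%E](probability_setT P) mule1.
- have -> : snd @^-1` A = setT `*` A :> set R2.
    by apply/seteqP; split => [x Ax//|x []].
  apply: etrans (product_measure1E _ _ measurableT mA) _.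
  by rewrite [X in (X * _)%E](probability_setT P) mul1e.
Qed.

Lemma measurable_unit_square : measurable (@unit_square R : set R2).
Proof. by apply: measurableX; exact: measurable_itv. Qed.

Lemma unif1E (A : set R1) : measurable A ->
  P A = lebesgue_measure (A `&` `[0, 1]%classic).
Proof.
move=> mA; rewrite /= /unif1/= /uniform_prob integral_uniform_pdf.
rewrite (eq_integral (fun=> 1%E)); last first.
  move=> x; rewrite inE => -[_ /=]; rewrite in_itv/= => x01.
  by rewrite /uniform_pdf x01 subr0 invr1.
by rewrite integral_cst ?mul1e//; exact: measurableI.
Qed.

Lemma coupling_unit_square mu : couplings mu -> mu (~` @unit_square R) = 0%E.
Proof.
move=> cmu; pose J : set R1 := ~` `[0, 1]%classic.
have mJ : measurable J by apply: measurableC; exact: measurable_itv.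
have PJ : P J = 0%E by rewrite unif1E// setICl measure0.
have [m1 m2] := cmu J mJ.
have mJ1 : measurable (fst @^-1` J : set R2).
  by rewrite -[X in measurable X]setTI; exact: measurable_fst.
have mJ2 : measurable (snd @^-1` J : set R2).
  by rewrite -[X in measurable X]setTI; exact: measurable_snd.
apply/eqP; rewrite -measure_le0.
apply: (@le_trans _ _ (mu (fst @^-1` J `|` snd @^-1` J))).
  apply: le_measure; rewrite ?inE.
  - by apply: measurableC; exact: measurable_unit_square.
  - exact: measurableU.
  - move=> z /=; rewrite /unit_square/= /setX/= => /not_andP[]; by [left|right].
apply: (le_trans (measureU2 _ _ _)) => //.
by rewrite [X in (X + _)%E]m1 [X in (_ + X)%E]m2 PJ adde0.
Qed.

Lemma Rintegral_unit_square mu (u v : R2 -> R) : couplings mu -> bmeas v ->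
  (forall z, unit_square z -> u z = v z) ->
  \int[mu]_(z in @unit_square R) u z = \int[mu]_z v z.
Proof.
move=> cmu bv uv; rewrite /Rintegral; congr fine.
have mN : measurable (~` @unit_square R : set R2).
  by apply: measurableC; exact: measurable_unit_square.
apply/esym; apply: etrans (negligible_integral mN measurableT
  (bmeas_integrable mu bv) (coupling_unit_square cmu)) _.
by rewrite setTD setCK; apply: eq_integral => z; rewrite inE => zs; rewrite /= uv.
Qed.

(** The restriction of the planar Lebesgue measure to the square is a product
    measure with the same factors as the uniform probability. *)
Lemma lebesgue_unif2 (X : set R2) : measurable X -> X `<=` @unit_square R ->
  (lebesgue_measure \x lebesgue_measure)%E X = unif2 R X.
Proof.
move=> mX Xsq; have msq := measurable_unit_square.
pose leb2 := (@lebesgue_measure R \x @lebesgue_measure R)%E.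
have -> : unif2 R X = mrestr leb2 msq X.
  apply: product_measure_unique => // A B mA mB; rewrite /mrestr.
  transitivity (leb2 ((A `&` `[0, 1]%classic) `*` (B `&` `[0, 1]%classic))).
    by congr leb2; apply/seteqP; split => z /= [] [? ?] [? ?].
  have mI : measurable (`[0, 1]%classic : set R1) by exact: measurable_itv.
  rewrite /leb2 product_measure1E; [|exact: measurableI..].
  by congr (_ * _)%E; apply/esym; exact: unif1E.
by rewrite /mrestr setIidl.
Qed.

End Couplings.

(** * The continuous variational problem *)

Section Optimum.
Variables (R : realType) (f : R * R -> R) (theta : R).
Local Notation R1 := (measurableTypeR R).
Local Notation R2 := (measurableTypeR R * measurableTypeR R)%type.
Local Notation P := (unif1 R).
Local Notation I1 := (fun u : R1 -> R => \int[P]_x u x).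
Hypothesis cf : {within @unit_square R, continuous f}.
Variable L : R2 -> R.
Hypothesis bL : bmeas L.
Hypothesis sL : schrodinger (@bmeas _ R1 R) I1
  (fun x y => theta * clamped f x y) (fun x y => L (x, y)).
Implicit Types mu : probability R2 R.

Let F (z : R2) := theta * clamped f z.1 z.2.

Let bF : bmeas F.
Proof.
exact: (adm_scale (averaging_Rintegral (unif2 R)) theta (bmeas_clamped cf)).
Qed.

Definition opt_value : R := - \int[unif2 R]_z (L z - F z).

(** L - F is a function of x plus a function of y, so that its integral
    depends on the marginals only. *)
Lemma coupling_separable mu : couplings mu ->
  \int[mu]_z L z = \int[mu]_z F z - opt_value.
Proof.
have [_ _ [a [b [ba bb LE]]]] := sL.
have H nu : couplings nu -> \int[nu]_z (L z - F z) = I1 a + I1 b.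
  move=> cnu; have HN := averaging_Rintegral nu.
  have ba' : bmeas (fun z : R2 => a z.1).
    exact: (bmeas_comp (g := fst : R2 -> R1) measurable_fst ba).
  have bb' : bmeas (fun z : R2 => b z.2).
    exact: (bmeas_comp (g := snd : R2 -> R1) measurable_snd bb).
  rewrite -(coupling_fst cnu ba) -(coupling_snd cnu bb) -(avgD HN ba' bb').
  by apply: eq_Rintegral => -[x y] _; rewrite LE /F/=; ring.
move=> cmu; rewrite /opt_value opprK (H _ (@coupling_unif2 R)) -(H _ cmu).
have HM := averaging_Rintegral mu.
have bLF : bmeas (fun z => L z - F z).
  exact: (adm_add HM bL (adm_opp HM bF)).
rewrite -(avgD HM bF bLF); apply: eq_Rintegral => z _; ring.
Qed.

Lemma objE mu : couplings mu ->
  obj f theta mu = ((\int[mu]_z F z)%:E - KL mu (unif2 R))%E.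
Proof.
move=> cmu; rewrite /obj; congr (_%:E - _)%E.
rewrite (Rintegral_unit_square cmu (bmeas_clamped cf)).
  by rewrite -(avgZ (averaging_Rintegral mu) theta (bmeas_clamped cf)).
by move=> z sz; rewrite clamped_square.
Qed.

Lemma expR_L_mass : (\int[unif2 R]_z (expR (L z))%:E = 1)%E.
Proof.
have HM := averaging_Rintegral (unif2 R).
have bE : bmeas (fun z => expR (L z)) by exact: adm_exp HM _ bL.
have [row _ _] := sL.
have : \int[unif2 R]_z expR (L z) = 1.
  rewrite (Rintegral_unif2 bE).
  under eq_Rintegral do rewrite row.
  exact: avg1 (averaging_Rintegral P).
rewrite /Rintegral => E; rewrite -[LHS]fineK ?E//.
by apply: integrable_fin_num => //; exact: (bmeas_integrable (unif2 R)).
Qed.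

Lemma optimal_coupling : exists mu, couplings mu /\
  forall A, measurable A ->
    (mu A = \int[unif2 R]_(z in A) (expR (L z))%:E)%E.
Proof.
have HM := averaging_Rintegral (unif2 R); have HP := averaging_Rintegral P.
have bE : bmeas (fun z => expR (L z)) by exact: adm_exp HM _ bL.
have [mu muE] := @density_probability _ _ _ (unif2 R) (fun z => expR (L z))
  (proj1 bE) (fun z => expR_ge0 _) expR_L_mass.
exists mu; split => // A mA.
have [row col _] := sL.
have b1 (p : R2 -> R1) : measurable_fun setT p ->
    bmeas (fun z => \1_A (p z) * expR (L z)).
  move=> mp; apply: (adm_mul HM) => //.
  exact: (bmeas_comp mp (bmeas_indic R mA)).
have key (p : R2 -> R1) : measurable_fun setT p ->
   \int[unif2 R]_z (\1_A (p z) * expR (L z)) = I1 \1_A ->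
   mu (p @^-1` A) = P A.
  move=> mp E.
  have mpA : measurable (p @^-1` A) by rewrite -[X in measurable X]setTI; exact: mp.
  rewrite muE//; have fA : (\int[unif2 R]_(z in p @^-1` A) (expR (L z))%:E)%E
      = (\int[unif2 R]_z (\1_A (p z) * expR (L z))%:E)%E.
    rewrite integral_mkcond; apply: eq_integral => z _; rewrite patchE indicE.
    have [zA|zA] := boolP (z \in p @^-1` A).
      by rewrite mem_set ?mul1r//; rewrite inE in zA.
    by rewrite memNset ?mul0r// => Az; move: zA; rewrite notin_setE; exact.
  rewrite fA -[LHS]fineK; last first.
    apply: integrable_fin_num => //.
    exact: (bmeas_integrable (unif2 R) (b1 p mp)).
  apply: (etrans (congr1 EFin E)).
  rewrite /Rintegral integral_indic// setIT fineK//.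
  exact: fin_num_measure.
split; apply: key => //.
- rewrite (Rintegral_unif2 (b1 _ measurable_fst)); congr I1.
  apply/funext => x; have bx := bmeas_xsection x bE.
  by rewrite (avgZ HP (\1_A x) bx) row mulr1.
- rewrite (Rintegral_unif2_swap (b1 _ measurable_snd)); congr I1.
  apply/funext => y; have bx := bmeas_ysection y bE.
  by rewrite (avgZ HP (\1_A y) bx) col mulr1.
Qed.

Lemma obj_le mu : couplings mu -> (obj f theta mu <= opt_value%:E)%E.
Proof.
move=> cmu; rewrite (objE cmu).
have [munu|munu] := pselect (mu `<< unif2 R); last first.
  by rewrite /KL asboolF//= leNye.
have := gibbs_KL_ge bL munu expR_L_mass.
have fL : (\int[mu]_z (L z)%:E)%E \is a fin_num.
  by apply: integrable_fin_num => //; exact: bmeas_integrable.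
have -> : opt_value = \int[mu]_z F z - \int[mu]_z L z.
  by rewrite (coupling_separable cmu); ring.
rewrite -[X in (X <= _)%E]fineK// -/(Rintegral mu setT L) EFinB => h.
exact: leeB.
Qed.

Lemma obj_density mu : couplings mu ->
  (forall A, measurable A ->
    (mu A = \int[unif2 R]_(z in A) (expR (L z))%:E)%E) ->
  obj f theta mu = opt_value%:E.
Proof.
move=> cmu dmu; rewrite (objE cmu) (density_KL bL dmu).
have -> : opt_value = \int[mu]_z F z - \int[mu]_z L z.
  by rewrite (coupling_separable cmu); ring.
rewrite EFinB -[X in (_ - X)%E = _]fineK//.
by apply: integrable_fin_num => //; exact: bmeas_integrable.
Qed.

Lemma density_of_obj mu : couplings mu -> (opt_value%:E <= obj f theta mu)%E ->
  forall A, measurable A ->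
    (mu A = \int[unif2 R]_(z in A) (expR (L z))%:E)%E.
Proof.
move=> cmu; rewrite (objE cmu).
have [munu|munu] := pselect (mu `<< unif2 R); last first.
  by rewrite /KL asboolF//= leNgt ltNye.
move=> h; apply: (gibbs_KL_eq bL munu expR_L_mass).
have fL : (\int[mu]_z (L z)%:E)%E \is a fin_num.
  by apply: integrable_fin_num => //; exact: bmeas_integrable.
rewrite -[leRHS]fineK// -/(Rintegral mu setT L).
move: h; have -> : opt_value = \int[mu]_z F z - \int[mu]_z L z.
  by rewrite (coupling_separable cmu); ring.
case: (KL mu (unif2 R)) => [x| |]//=.
  by rewrite -EFinB !lee_fin lerD2l lerN2.
by rewrite leNye.
Qed.

Lemma Z_opt_value : Z f theta = opt_value%:E.
Proof.
have [mu [cmu dmu]] := optimal_coupling.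
apply/eqP; rewrite eq_le; apply/andP; split.
  by apply: ge_ereal_sup => _ [nu cnu <-]; exact: obj_le.
by apply: ereal_sup_ubound; exists mu => //; exact: obj_density.
Qed.

Lemma mu_opt_density A : measurable A ->
  (mu_opt f theta A = \int[unif2 R]_(z in A) (expR (L z))%:E)%E.
Proof.
have [mu [cmu dmu]] := optimal_coupling.
have am : argmax (@couplings R) (obj f theta) mu.
  by split => // nu cnu; rewrite (obj_density cmu dmu); exact: obj_le.
have [cm maxm] : argmax (@couplings R) (obj f theta) (mu_opt f theta).
  by apply: (xgetPex _ (ex_intro _ mu am)).
by apply: density_of_obj => //; rewrite -(obj_density cmu dmu); exact: maxm.
Qed.

Lemma Rintegral_g_opt (phi : R * R -> R) : {within @unit_square R, continuous phi} ->
  \int[(@lebesgue_measure R \x @lebesgue_measure R)%E]_(z in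
     @unit_square R) (phi z * g_opt f theta z) =
  \int[unif2 R]_z (clamped phi z.1 z.2 * expR (L z)).
Proof.
move=> cphi.
have munu := density_dominates bL mu_opt_density.
have gE := density_Radon_Nikodym bL mu_opt_density.
have mg : measurable_fun setT (g_opt f theta).
  have mRN : measurable_fun setT (Radon_Nikodym
      (charge_of_finite_measure (mu_opt f theta)) (unif2 R)).
    apply: (measurable_int (unif2 R)); exact: Radon_Nikodym_integrable.
  by rewrite /g_opt; apply: measurableT_comp mRN.
have [mphi _] := bmeas_clamped cphi.
have HM := averaging_Rintegral (unif2 R).
have bphi : bmeas (fun z => clamped phi z.1 z.2 * expR (L z)).
  by apply: (adm_mul HM (bmeas_clamped cphi)); exact: adm_exp HM _ bL.
rewrite -(Rintegral_unit_square (@coupling_unif2 R) bphi (fun _ _ => erefl)).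
rewrite /Rintegral; congr fine.
have msq := @measurable_unit_square R.
transitivity (\int[unif2 R]_(z in @unit_square R)
   (clamped phi z.1 z.2 * g_opt f theta z)%:E)%E.
  transitivity (\int[unif2 R]_(z in @unit_square R)
     (phi z * g_opt f theta z)%:E)%E.
    by apply: eq_measure_integral => A mA Asq; exact: lebesgue_unif2.
  by apply: eq_integral => z; rewrite inE => /clamped_square ->.
apply: ae_eq_integral => //.
- by apply/measurable_EFinP; apply: measurable_funTS; exact: measurable_funM.
- by apply/measurable_EFinP; apply: measurable_funTS; case: bphi.
- by apply: filterS gE => z /(_ Logic.I) gz _; rewrite /= /g_opt gz.
Qed.

End Optimum.

(** * Passage from the discrete problems to the continuous one *)

Lemma sinkhorn_limit_family (R : realType) (f : R * R -> R) :
  exists (A : forall k : nat, R -> 'M[R]_k)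
    (l : forall n : nat, R -> 'I_n.+1 -> 'I_n.+1 -> R),
  forall n theta,
    sinkhorn n.+1 f theta m @[m --> \oo] --> A n.+1 theta /\
    optimal f theta (A n.+1 theta) (l n theta).
Proof.
have H n theta : exists Al : 'M[R]_n.+1 * ('I_n.+1 -> 'I_n.+1 -> R),
    sinkhorn n.+1 f theta m @[m --> \oo] --> Al.1 /\ optimal f theta Al.1 Al.2.
  by have [A [l [cA MA sl AE]]] := sinkhorn_limit n f theta; exists (A, l).
exists (fun k => match k with
  | 0 => fun=> 0 | n.+1 => fun theta => (sval (cid (H n theta))).1 end).
exists (fun n theta => (sval (cid (H n theta))).2) => n theta.
by case: (cid (H n theta)).
Qed.

Theorem theorem1p8 (R : realType) (f : R * R -> R) (hf : classC f) :
  exists A : forall k : nat, R -> 'M[R]_k,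
  [/\ (* (a) *)
      forall (theta : R) (k : nat), (0 < k)%N ->
        Mk (A k theta) /\ sinkhorn k f theta m @[m --> \oo] --> A k theta,
      (* (b) *)
      forall (theta : R) (k : nat), (0 < k)%N ->
        argmax (@Mk R k) (objk f theta) = [set A k theta],
      (* (c) *)
      forall k : nat, (0 < k)%N ->
        convex_function (E := R^o) setT (W k f) /\
        (forall theta : R,
          derivable (W k f) theta 1 /\
          derive1 (W k f) theta
            = \sum_r \sum_s A k theta r s * f (grid R r s)),
      (* (d) *)
      forall (theta : R) (phi : R * R -> R),
        {within @unit_square R, continuous phi} ->
        (\sum_r \sum_s A k theta r s * phi (grid R r s)) @[k --> \oo] -->
          \int[(@lebesgue_measure R \x @lebesgue_measure R)%E]_(z in
             @unit_square R) (phi z * g_opt f theta z) &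
      forall theta : R,
        [/\ (W k f theta)%:E @[k --> \oo] --> Z f theta,
            forall k : nat, (0 < k)%N ->
              cvg (objk f theta (sinkhorn k f theta m) @[m --> \oo]) &
            (lim (objk f theta (sinkhorn k f theta m) @[m --> \oo]))%:E
              @[k --> \oo] --> Z f theta]].
Proof.
have [cf _ _ _] := hf.
have [A [l Al]] := sinkhorn_limit_family f.
have oA n theta : optimal f theta (A n.+1 theta) (l n theta).
  by have [] := Al n theta.
have WZ theta : (W k f theta)%:E @[k --> \oo] --> Z f theta.
  have [L [bL cL sL]] := schrodinger_limit cf (oA ^~ theta).
  rewrite (Z_opt_value cf bL sL) -cvg_shiftS.
  apply: cvg_EFin; first by apply: nearW.
  exact: (W_limit cf (oA ^~ theta) bL cL).
have objW n theta : objk f theta (sinkhorn n.+1 f theta m) @[m --> \oo] -->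
    W n.+1 f theta.
  by have [cA _] := Al n theta; exact: objk_cvg (oA n theta) cA.
exists A; split.
- by move=> theta [//|n] _; have [cA [MA _ _]] := Al n theta.
- by move=> theta [//|n] _; exact: argmax_objk (oA n theta).
- move=> [//|n] _; split; first exact: W_convex.
  by move=> theta; exact: (W_derivative (oA n)).
- move=> theta phi cphi; have [L [bL cL sL]] := schrodinger_limit cf (oA ^~ theta).
  rewrite (Rintegral_g_opt cf bL sL cphi) -cvg_shiftS.
  exact: (obs_limit (oA ^~ theta) bL cL cphi).
- move=> theta; split => //.
    by move=> [//|n] _; apply/cvg_ex; exists (W n.+1 f theta); exact: objW.
  move: (WZ theta); rewrite -cvg_shiftS -[X in _ -> X]cvg_shiftS.
  by under [X in _ -> X @ _ --> _]eq_fun do rewrite (cvg_lim _ (objW _ _))//.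
Qed.
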